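(* For every $\Omega$-spectrum $E$, the class of $E^*$-acyclic simplicial sets is $\mathbf{\Delta}_2$ with $E$ as a parameter; that is, it can be defined both by a $\Sigma_2$ formula and by a $\Pi_2$ formula of the language of set theory with $E$ as a parameter.
   Context: We work in ZFC. $\Sigma_0=\Pi_0$ formulas of the language of set theory are those with only bounded quantifiers; $\Sigma_{n+1}$ formulas have the form $\exists x_1\cdots x_k\,\varphi$ with $\varphi$ a $\Pi_n$ formula; $\Pi_{n+1}$ formulas have the form $\forall x_1\cdots x_k\,\varphi$ with $\varphi$ a $\Sigma_n$ formula. (Definability is understood up to equivalence provable in ZFC.) Simplicial sets are pointed here. $SX=\mathbb{S}^1\wedge X$ denotes suspension; $\mathrm{map}_*(X,Y)$ is the pointed function complex, whose $n$-simplices are the pointed maps $X\wedge\Delta[n]_+\to Y$; $\Omega X=\mathrm{map}_*(\mathbb{S}^1,X)$; $[X,Y]$ is the set of morphisms in the pointed homotopy category of simplicial sets. A spectrum $E$ (in the sense of Bousfield–Friedlander) is a sequence of pointed simplicial sets $(E_n,p_n)$, $0\le n<\omega$, with pointed simplicial maps $\sigma_n\colon SE_n\to E_{n+1}$. It is an $\Omega$-spectrum if each $E_n$ is fibrant (a Kan complex) and the adjoints $E_n\to\Omega E_{n+1}$ of the maps $\sigma_n$ are weak equivalences. An $\Omega$-spectrum $E$ defines a reduced cohomology theory by $E^k(X)=\mathrm{colim}_n\,\pi_{n-k}(\mathrm{map}_*(X,E_n))=\mathrm{colim}_n\,[S^nX,E_{n+k}]$ for $k\in\mathbb{Z}$.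 A simplicial set $X$ is $E^*$-acyclic if $E^k(X)=0$ for all $k\in\mathbb{Z}$. *)

(* Defs.v *)
From Stdlib Require Import ClassicalEpsilon.

(** Variables are de Bruijn indices. *)
Inductive form : Type :=
| fEq  (i j : nat)
| fMem (i j : nat)
| fNot (p : form)
| fAnd (p q : form)
| fOr  (p q : form)
| fImp (p q : form)
| fEx  (p : form)
| fAll (p : form).

(** In the bounded quantifiers the bound is variable [j] of the outer context,
    hence [S j] under the quantifier. *)
Inductive Delta0 : form -> Prop :=
| D_eq   i j : Delta0 (fEq i j)
| D_mem  i j : Delta0 (fMem i j)
| D_not  p   : Delta0 p -> Delta0 (fNot p)
| D_and  p q : Delta0 p -> Delta0 q -> Delta0 (fAnd p q)
| D_or   p q : Delta0 p -> Delta0 q -> Delta0 (fOr p q)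
| D_imp  p q : Delta0 p -> Delta0 q -> Delta0 (fImp p q)
| D_bex  j p : Delta0 p -> Delta0 (fEx (fAnd (fMem 0 (S j)) p))
| D_ball j p : Delta0 p -> Delta0 (fAll (fImp (fMem 0 (S j)) p)).

Fixpoint exs (k : nat) (p : form) : form :=
  match k with 0 => p | S k' => fEx (exs k' p) end.

Fixpoint alls (k : nat) (p : form) : form :=
  match k with 0 => p | S k' => fAll (alls k' p) end.

Fixpoint Sigma (n : nat) (p : form) : Prop :=
  match n with
  | 0 => Delta0 p
  | S n' => exists (k : nat) (q : form), Pi n' q /\ p = exs (S k) q
  end
with Pi (n : nat) (p : form) : Prop :=
  match n with
  | 0 => Delta0 p
  | S n' => exists (k : nat) (q : form), Sigma n' q /\ p = alls (S k) q
  end.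

Record structure : Type := Structure {
  carrier :> Type;
  mem : carrier -> carrier -> Prop;
  nonempty : inhabited carrier
}.

Arguments mem {s} _ _.
Notation "x ∈ y" := (mem x y) (at level 70, no associativity).

Definition scons {A : Type} (x : A) (r : nat -> A) (n : nat) : A :=
  match n with 0 => x | S n' => r n' end.

Fixpoint sat {M : structure} (r : nat -> M) (p : form) : Prop :=
  match p with
  | fEq i j  => r i = r j
  | fMem i j => r i ∈ r j
  | fNot p   => ~ sat r p
  | fAnd p q => sat r p /\ sat r q
  | fOr p q  => sat r p \/ sat r q
  | fImp p q => sat r p -> sat r q
  | fEx p    => exists x : M, sat (scons x r) p
  | fAll p   => forall x : M, sat (scons x r) p
  end.

(** First-order ZFC: Separation and Replacement are schemes over [form], with
    parameters supplied by the assignment [r]. *)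
Record ZFC (M : structure) : Prop := {
  zf_ext : forall a b : M, (forall x, x ∈ a <-> x ∈ b) -> a = b;
  zf_found : forall a : M, (exists x, x ∈ a) ->
    exists x, x ∈ a /\ forall y, y ∈ a -> ~ y ∈ x;
  zf_pair : forall a b : M, exists c, forall x, x ∈ c <-> x = a \/ x = b;
  zf_union : forall a : M, exists c, forall x, x ∈ c <-> exists y, y ∈ a /\ x ∈ y;
  zf_power : forall a : M, exists c, forall x,
    x ∈ c <-> forall y, y ∈ x -> y ∈ a;
  zf_infinity : exists w : M,
    (exists e, e ∈ w /\ forall x, ~ x ∈ e) /\
    (forall n, n ∈ w -> exists s, s ∈ w /\ forall x, x ∈ s <-> x ∈ n \/ x = n);
  zf_sep : forall (p : form) (r : nat -> M) (a : M), exists b, forall x,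
    x ∈ b <-> x ∈ a /\ sat (scons x r) p;
  zf_repl : forall (p : form) (r : nat -> M) (a : M),
    (forall x y z, x ∈ a -> sat (scons y (scons x r)) p ->
       sat (scons z (scons x r)) p -> y = z) ->
    exists b, forall y, y ∈ b <-> exists x, x ∈ a /\ sat (scons y (scons x r)) p;
  zf_choice : forall a : M,
    (forall x, x ∈ a -> exists y, y ∈ x) ->
    (forall x y z, x ∈ a -> y ∈ a -> z ∈ x -> z ∈ y -> x = y) ->
    exists c, forall x, x ∈ a -> exists! y, y ∈ x /\ y ∈ c
}.

(** The assignment interpreting variable 0 as [x] and all other variables as
    the parameter [e], so that no further parameter is available. *)
Definition with_param {M : structure} (x e : M) : nat -> M :=
  scons x (fun _ => e).

(** All the notions below are first-order over [(M, mem)]: quantifiers range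
    over [M], and natural numbers, integers, functions, simplicial sets and
    spectra are elements of [M]. *)

(** Definite description: the unique [y] such that [P y], and the empty set if
    there is not exactly one such [y].  The default makes [the P] first-order
    definable whenever [P] is. *)
Definition the {M : structure} (P : M -> Prop) : M :=
  epsilon (nonempty M) (fun y =>
    unique P y \/ (~ (exists z, unique P z) /\ forall z, ~ z ∈ y)).

(** The set of all [x] such that [P x], provided that these form a set. *)
Definition cls {M : structure} (P : M -> Prop) : M :=
  the (fun y => forall x, x ∈ y <-> P x).

Notation "⦃ x | P ⦄" := (cls (fun x => P)) (at level 0, x name, P at level 200).

Section SetTheory.
Context {M : structure}.
Implicit Types a b c f g i j k l m n p q r s t u v w x y z : M.

Definition empty : M := ⦃ x | False ⦄.
Definition sing a : M := ⦃ x | x = a ⦄.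
Definition unsing a : M := the (fun x => a = sing x).
Definition upair a b : M := ⦃ x | x = a \/ x = b ⦄.
Definition opair a b : M := upair (sing a) (upair a b).
Definition pi1 p : M := the (fun a => exists b, p = opair a b).
Definition pi2 p : M := the (fun b => exists a, p = opair a b).
Definition subset a b : Prop := forall x, x ∈ a -> x ∈ b.

Definition succ n : M := ⦃ x | x ∈ n \/ x = n ⦄.
Definition one : M := succ empty.
Definition inductive w : Prop :=
  empty ∈ w /\ forall n, n ∈ w -> succ n ∈ w.
Definition omega : M := ⦃ n | forall w, inductive w -> n ∈ w ⦄.

Definition func f a : Prop :=
  (forall p, p ∈ f -> exists x y, x ∈ a /\ p = opair x y) /\
  (forall x, x ∈ a -> exists! y, opair x y ∈ f).
Definition app f x : M := the (fun y => opair x y ∈ f).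
Definition is_fun f a b : Prop := func f a /\ forall x, x ∈ a -> app f x ∈ b.
Definition lam a (F : M -> M) : M := ⦃ p | exists x, x ∈ a /\ p = opair x (F x) ⦄.

(** [comp g f] is "g after f". *)
Definition comp g f : M :=
  ⦃ p | exists x y z, opair x y ∈ f /\ opair y z ∈ g /\ p = opair x z ⦄.

(** The [n]-th iterate of [F] at [a], for [n] in [omega]. *)
Definition iter a (F : M -> M) n : M :=
  the (fun v => exists t, func t omega /\ app t empty = a /\
    (forall i, i ∈ omega -> app t (succ i) = F (app t i)) /\ v = app t n).
Definition add a b : M := iter a succ b.

(** The set of order-preserving maps [m] -> [n], where [n] = {0,...,n} is the
    von Neumann ordinal [succ n]; for natural numbers, inclusion is the order. *)
Definition mono m n : M :=
  ⦃ f | is_fun f (succ m) (succ n) /\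
        forall i j, i ∈ succ m -> j ∈ succ m -> subset i j ->
          subset (app f i) (app f j) ⦄.
Definition idm n : M := lam (succ n) (fun i => i).
Definition cst n i : M := lam (succ n) (fun _ => i).

(** The morphism [f : [m] -> [n]] of the simplex category is coded by
    [tri m n f]; the graph [f] alone does not determine [n]. *)
Definition tri m n f : M := opair m (opair n f).
Definition simplex_mor : M :=
  ⦃ t | exists m n f, m ∈ omega /\ n ∈ omega /\ f ∈ mono m n /\ t = tri m n f ⦄.

(** A simplicial set is a contravariant functor on the simplex category: a pair
    consisting of the family of its sets of simplices and of the family of
    maps by which the morphisms of the simplex category act. *)
Definition simp X n : M := app (pi1 X) n.
Definition act X m n f x : M := app (app (pi2 X) (tri m n f)) x.

Definition is_sset (X : M) : Prop :=
  X = opair (pi1 X) (pi2 X) /\ func (pi1 X) omega /\ func (pi2 X) simplex_mor /\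
  (forall m n f, m ∈ omega -> n ∈ omega -> f ∈ mono m n ->
     is_fun (app (pi2 X) (tri m n f)) (simp X n) (simp X m)) /\
  (forall n x, n ∈ omega -> x ∈ simp X n -> act X n n (idm n) x = x) /\
  (forall l m n f g x, l ∈ omega -> m ∈ omega -> n ∈ omega ->
     f ∈ mono m n -> g ∈ mono l m -> x ∈ simp X n ->
     act X l n (comp f g) x = act X l m g (act X m n f x)).

Definition mk_sset (C : M -> M) (A : M -> M -> M -> M -> M) : M :=
  opair (lam omega C)
        (lam simplex_mor (fun t =>
           let m := pi1 t in let n := pi1 (pi2 t) in let f := pi2 (pi2 t) in
           lam (C n) (fun x => A m n f x))).

(** Simplicial maps are functions on [omega] whose value at [n] is the
    component in degree [n]. *)
Definition ap f n x : M := app (app f n) x.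

Definition smap f X Y : Prop :=
  func f omega /\
  (forall n, n ∈ omega -> is_fun (app f n) (simp X n) (simp Y n)) /\
  (forall m n h x, m ∈ omega -> n ∈ omega -> h ∈ mono m n -> x ∈ simp X n ->
     ap f m (act X m n h x) = act Y m n h (ap f n x)).

Definition mk_smap X (F : M -> M -> M) : M :=
  lam omega (fun n => lam (simp X n) (fun x => F n x)).

Definition simplex n : M :=
  mk_sset (fun q => mono q n) (fun _ _ h x => comp x h).

Definition sub_sset X (P : M -> M -> Prop) : M :=
  mk_sset (fun n => ⦃ x | x ∈ simp X n /\ P n x ⦄) (fun m n h x => act X m n h x).

Definition sprod X Y : M :=
  mk_sset (fun n => ⦃ u | exists x y, x ∈ simp X n /\ y ∈ simp Y n /\ u = opair x y ⦄)
          (fun m n h u => opair (act X m n h (pi1 u)) (act Y m n h (pi2 u))).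

Definition boundary n (q f : M) : Prop :=
  exists i, i ∈ succ n /\ forall j, j ∈ succ q -> app f j <> i.
(** The simplices of [simplex n] which miss a vertex other than [k]. *)
Definition horn n k (q f : M) : Prop :=
  exists i, i ∈ succ n /\ i <> k /\ forall j, j ∈ succ q -> app f j <> i.

Definition is_Kan X : Prop :=
  forall n k f, n ∈ omega -> k ∈ succ (succ n) ->
    smap f (sub_sset (simplex (succ n)) (horn (succ n) k)) X ->
    exists g, smap g (simplex (succ n)) X /\
      forall q x, q ∈ omega ->
        x ∈ simp (sub_sset (simplex (succ n)) (horn (succ n) k)) q ->
        ap g q x = ap f q x.

(** A pointed simplicial set is a pair [(X, p)] with [p] a vertex of [X]. *)
Definition und P : M := pi1 P.
Definition pt P : M := pi2 P.
Definition psimp P n : M := simp (und P) n.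
Definition bp P n : M := act (und P) n empty (cst n empty) (pt P).

Definition is_psset P : Prop :=
  P = opair (und P) (pt P) /\ is_sset (und P) /\ pt P ∈ psimp P empty.
Definition pmap f P Q : Prop :=
  smap f (und P) (und Q) /\ ap f empty (pt P) = pt Q.
Definition mk_pmap P (F : M -> M -> M) : M := mk_smap (und P) F.
Definition pcomp P g f : M := mk_pmap P (fun n x => ap g n (ap f n x)).

(** The quotient [X/L], for [L] a simplicial subset of [X] given as a predicate
    on degrees and simplices.  The base simplex is coded by [empty], and each
    simplex [x] outside [L] by [sing x]; [qcls] is the projection.  When [L] is
    empty this adds a disjoint base point.  [qmap] is the map of quotients
    induced by a map [F] of representatives. *)
Definition qcls (L : M -> M -> Prop) n x : M :=
  the (fun w => (L n x /\ w = empty) \/ (~ L n x /\ w = sing x)).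
Definition qmap (L : M -> M -> Prop) n (F : M -> M) z : M :=
  the (fun w => (z = empty /\ w = empty) \/
                exists x, z = sing x /\ w = qcls L n (F x)).
Definition quo X (L : M -> M -> Prop) : M :=
  opair (mk_sset
           (fun n => ⦃ z | z = empty \/ exists x, x ∈ simp X n /\ ~ L n x /\ z = sing x ⦄)
           (fun m n h z => qmap L m (act X m n h) z))
        empty.

Definition none (_ _ : M) : Prop := False.
Definition simplex_plus n : M := quo (simplex n) none.
Definition sphere1 : M := quo (simplex one) (boundary one).

Definition wedge P Q (n u : M) : Prop := pi1 u = bp P n \/ pi2 u = bp Q n.
Definition smash P Q : M := quo (sprod (und P) (und Q)) (wedge P Q).
(** The simplex of [smash P Q] represented by the pair [(x, y)]. *)
Definition smash_elt P Q n x y : M := qcls (wedge P Q) n (opair x y).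
(** The degree [n] component of the smash product [P /\ Q -> P' /\ Q'] of the
    pointed maps whose degree [n] components are [F] and [G]. *)
Definition smash_fun P' Q' n (F G : M -> M) z : M :=
  qmap (wedge P' Q') n (fun u => opair (F (pi1 u)) (G (pi2 u))) z.

Definition susp P : M := smash sphere1 P.
Definition sphere n : M := iter (simplex_plus empty) susp n.

Definition map_pt P Q : M :=
  opair (mk_sset
           (fun n => ⦃ f | pmap f (smash P (simplex_plus n)) Q ⦄)
           (fun m n h f =>
              mk_pmap (smash P (simplex_plus m)) (fun q z =>
                ap f q (smash_fun P (simplex_plus n) q
                          (fun x => x) (qmap none q (comp h)) z))))
        (mk_pmap (smash P (simplex_plus empty)) (fun q _ => bp Q q)).

Definition loops P : M := map_pt sphere1 P.

Definition homotopic P Q f g : Prop :=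
  exists h, pmap h (smash P (simplex_plus one)) Q /\
    forall q z, q ∈ omega -> z ∈ psimp P q ->
      ap h q (smash_elt P (simplex_plus one) q z (sing (cst q empty))) = ap f q z /\
      ap h q (smash_elt P (simplex_plus one) q z (sing (cst q one))) = ap g q z.

(** For a pointed Kan complex [K], the set [pi_m K] is the set of pointed maps
    [sphere m -> K] modulo [homotopic].  A map between Kan complexes with at
    least one vertex is a weak equivalence if it induces a bijection on [pi_m]
    for all [m] and all choices of the base vertex. *)
Definition weak_equiv_Kan f X Y : Prop :=
  forall v m, v ∈ simp X empty -> m ∈ omega ->
    let K := opair X v in let L := opair Y (ap f empty v) in
    (forall g g', pmap g (sphere m) K -> pmap g' (sphere m) K ->
       homotopic (sphere m) L (pcomp (sphere m) f g) (pcomp (sphere m) f g') ->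
       homotopic (sphere m) K g g') /\
    (forall h, pmap h (sphere m) L -> exists g, pmap g (sphere m) K /\
       homotopic (sphere m) L (pcomp (sphere m) f g) h).

(** A spectrum is a pair consisting of the sequence of its pointed simplicial
    sets and the sequence of its structure maps. *)
Definition space E n : M := app (pi1 E) n.
Definition smap_of E n : M := app (pi2 E) n.

Definition is_spectrum E : Prop :=
  E = opair (pi1 E) (pi2 E) /\ func (pi1 E) omega /\ func (pi2 E) omega /\
  forall n, n ∈ omega ->
    is_psset (space E n) /\ pmap (smap_of E n) (susp (space E n)) (space E (succ n)).

(** The adjoint [P -> loops Q] of [f : susp P -> Q]: it sends a simplex [x] of
    degree [q] to [(s, h) |-> f (s, h^* x)], for [h] a simplex of [simplex q]. *)
Definition adjoint P f : M :=
  mk_pmap P (fun q x =>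
    mk_pmap (smash sphere1 (simplex_plus q)) (fun r z =>
      ap f r (smash_fun sphere1 P r (fun s => s)
                (fun b => act (und P) r q (unsing b) x) z))).

Definition is_Omega_spectrum E : Prop :=
  is_spectrum E /\
  forall n, n ∈ omega ->
    is_Kan (und (space E n)) /\
    weak_equiv_Kan (adjoint (space E n) (smap_of E n))
                   (und (space E n)) (und (loops (space E (succ n)))).

(** The degree [q] component of the natural map
    [A /\ map_pt X Y -> map_pt X (A /\ Y)], sending [(s, g)] to
    [(x, h) |-> (h^* s, g (x, h))]. *)
Definition assembly A X Y q z : M :=
  mk_pmap (smash X (simplex_plus q)) (fun r w =>
    the (fun v =>
      ((z = empty \/ w = empty) /\ v = empty) \/
      exists s g x h, z = sing (opair s g) /\ w = sing (opair x (sing h)) /\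
        v = smash_elt A Y r (act (und A) r q h s) (ap g r w))).

(** The map [pi_m (map_pt X E_n) -> pi_(m+1) (map_pt X E_(n+1))] on
    representatives: [g] is sent to the composite of [susp g] with
    [susp (map_pt X E_n) -> map_pt X (susp E_n) -> map_pt X E_(n+1)]. *)
Definition stab E X n m g : M :=
  mk_pmap (susp (sphere m)) (fun q z =>
    mk_pmap (smash X (simplex_plus q)) (fun r w =>
      ap (smap_of E n) r
        (ap (assembly sphere1 X (space E n) q
               (smash_fun sphere1 (map_pt X (space E n)) q
                  (fun s => s) (ap g q) z)) r w))).

(** The integer [k = a - b] is given by natural numbers [a] and [b].  An element
    of [E^k X = colim_n pi_(n-k) (map_pt X E_n)] is represented by a triple
    [(n, (m, g))] with [m = n - k] and [g : sphere m -> map_pt X E_n]. *)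
Definition coh_rep E X a b t : Prop :=
  exists n m g, n ∈ omega /\ m ∈ omega /\ add m a = add n b /\
    pmap g (sphere m) (map_pt X (space E n)) /\ t = opair n (opair m g).

Definition coh_step E X t : M :=
  let n := pi1 t in let m := pi1 (pi2 t) in let g := pi2 (pi2 t) in
  opair (succ n) (opair (succ m) (stab E X n m g)).

(** Two representatives define the same element of the colimit if they become
    homotopic at a common later stage. *)
Definition coh_eq E X t t' : Prop :=
  exists i j n m g g', i ∈ omega /\ j ∈ omega /\
    iter t (coh_step E X) i = opair n (opair m g) /\
    iter t' (coh_step E X) j = opair n (opair m g') /\
    homotopic (sphere m) (map_pt X (space E n)) g g'.

Definition cohomology E X a b : M :=
  ⦃ c | exists t, coh_rep E X a b t /\
        c = ⦃ t' | coh_rep E X a b t' /\ coh_eq E X t t' ⦄ ⦄.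

(** [E^k X = 0] says that the underlying set of the group has one element. *)
Definition is_acyclic E X : Prop :=
  is_psset X /\
  forall a b, a ∈ omega -> b ∈ omega -> exists z, cohomology E X a b = sing z.

End SetTheory.

(* Main.v *)
From Stdlib Require Import ClassicalEpsilon Lia.
Require Import Defs.

(** Acyclicity is a local property: everything that enters into its definition
    is obtained from [X], [E] and the natural numbers by a fixed finite number of
    power sets and pairings.

    Call a set a universe if it is transitive, closed under subsets, and
    contains with [x] and [a] some set having as members [a], the members of
    [x], their members, and the subsets of [x] (for instance, the sets of rank
    less than a limit ordinal).  Only the closure under subsets is not a
    bounded condition, and it takes one universal quantifier, so that being a
    universe is a [Pi 1] property.  If a universe [U] contains [X], [E] and
    some smaller universe [W], which provides the natural numbers, then
    acyclicity of [X] is equivalent to its relativisation to [U], in which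
    every quantifier is bounded by [U] ([local_is_acyclic]).  Such universes
    exist ([exists_universe]: the union of the iterates of [grow]).  Hence [X] is acyclic if and only if the
    relativisation holds in some such [U], which is [Sigma 2], and if and only
    if it holds in all of them, which is [Pi 2].

    The equivalence with the relativisation is proved by a calculus which
    follows the syntax of the definitions.  A predicate is [local] if one
    formula, relativised to any universe, defines it there.  For an element
    given by a description, locality of the describing predicate is not
    sufficient: the element itself must lie in the universe, and so must sets
    like the set of all [F x] for [x] in [a].  Therefore a term is [localT] if
    moreover it is [bounded], i.e. lies a fixed number of steps of [grow] above
    its arguments.  Quantifiers and comprehensions over all sets are allowed as
    soon as the relevant sets are bounded in this sense.

    Boundedness is not automatic for recursion along the natural numbers,
    because each step could add to the rank.  [localT_guarded_iter] asks for an
    invariant set of bounded level.  For the spheres, one takes the pointed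
    simplicial sets with all simplices in [W] ([invariant_sphere]): the
    simplices of a sphere are hereditarily finite.  For the stabilisation of
    cohomology classes, the level of [stab E X n m g] does not depend on [g],
    because its values are maps whose values are simplices of [E]
    ([stab_level], [invariant_coh_step]). *)

(** * Relativised satisfaction *)

Fixpoint satU {M : structure} (U : M) (r : nat -> M) (p : form) : Prop :=
  match p with
  | fEq i j  => r i = r j
  | fMem i j => r i ∈ r j
  | fNot p   => ~ satU U r p
  | fAnd p q => satU U r p /\ satU U r q
  | fOr p q  => satU U r p \/ satU U r q
  | fImp p q => satU U r p -> satU U r q
  | fEx p    => exists x : M, x ∈ U /\ satU U (scons x r) p
  | fAll p   => forall x : M, x ∈ U -> satU U (scons x r) p
  end.

Definition up_ren (v : nat -> nat) (n : nat) : nat :=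
  match n with 0 => 0 | S k => S (v k) end.

(** Bounds all the quantifiers by the variable [u]; the free variables are
    renamed by [v] to make room for it. *)
Fixpoint rel (v : nat -> nat) (u : nat) (p : form) : form :=
  match p with
  | fEq i j  => fEq (v i) (v j)
  | fMem i j => fMem (v i) (v j)
  | fNot p   => fNot (rel v u p)
  | fAnd p q => fAnd (rel v u p) (rel v u q)
  | fOr p q  => fOr (rel v u p) (rel v u q)
  | fImp p q => fImp (rel v u p) (rel v u q)
  | fEx p    => fEx (fAnd (fMem 0 (S u)) (rel (up_ren v) (S u) p))
  | fAll p   => fAll (fImp (fMem 0 (S u)) (rel (up_ren v) (S u) p))
  end.

Lemma Delta0_rel p : forall v u, Delta0 (rel v u p).
Proof. induction p; simpl; intros; constructor; auto. Qed.

Lemma sat_rel {M : structure} p : forall v u (r r' : nat -> M),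
  (forall i, r' (v i) = r i) ->
  (sat r' (rel v u p) <-> satU (r' u) r p).
Proof.
  assert (up : forall v (x : M) (r r' : nat -> M), (forall i, r' (v i) = r i) ->
            forall i, scons x r' (up_ren v i) = scons x r i)
    by (intros v x r r' H [|i]; simpl; auto).
  induction p; simpl; intros v u r r' H.
  1, 2: rewrite !H; tauto.
  1: rewrite (IHp v u r r' H); tauto.
  1, 2, 3: rewrite (IHp1 v u r r' H), (IHp2 v u r r' H); tauto.
  - split; intros [x [Hx H']]; exists x; split; auto;
      apply (IHp (up_ren v) (S u) (scons x r) (scons x r')); auto.
  - split; intros H' x Hx; apply (IHp (up_ren v) (S u) (scons x r) (scons x r')); auto;
      apply H'; auto.
Qed.

Fixpoint ren (v : nat -> nat) (p : form) : form :=
  match p with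
  | fEq i j  => fEq (v i) (v j)
  | fMem i j => fMem (v i) (v j)
  | fNot p   => fNot (ren v p)
  | fAnd p q => fAnd (ren v p) (ren v q)
  | fOr p q  => fOr (ren v p) (ren v q)
  | fImp p q => fImp (ren v p) (ren v q)
  | fEx p    => fEx (ren (up_ren v) p)
  | fAll p   => fAll (ren (up_ren v) p)
  end.

Lemma satU_ren {M : structure} (U : M) p : forall v (r r' : nat -> M),
  (forall i, r' (v i) = r i) -> (satU U r' (ren v p) <-> satU U r p).
Proof.
  assert (up : forall v (x : M) (r r' : nat -> M), (forall i, r' (v i) = r i) ->
            forall i, scons x r' (up_ren v i) = scons x r i)
    by (intros v x r r' H [|i]; simpl; auto).
  induction p; simpl; intros v r r' H.
  1, 2: rewrite !H; tauto.
  1: rewrite (IHp v r r' H); tauto.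
  1, 2, 3: rewrite (IHp1 v r r' H), (IHp2 v r r' H); tauto.
  - split; intros [x [Hx H']]; exists x; split; auto;
      apply (IHp (up_ren v) (scons x r) (scons x r')); auto.
  - split; intros H' x Hx; apply (IHp (up_ren v) (scons x r) (scons x r')); auto.
Qed.

(** * Expressible predicates *)

(** Families of predicates and of elements, depending on an assignment: the
    semantic counterparts of formulas and of terms with free variables.  They
    range over all structures because a formula has to be found before the
    structure is given. *)
Definition pred := forall M : structure, (nat -> M) -> Prop.
Definition term := forall M : structure, (nat -> M) -> M.

(** The flag selects between arbitrary and [Delta0] formulas. *)
Definition expr (b : bool) (P : pred) : Prop :=
  exists p, (b = true -> Delta0 p) /\ forall (M : structure) (r : nat -> M), P M r <-> sat r p.

Lemma expr_eq b i j : expr b (fun M r => r i = r j).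
Proof. exists (fEq i j). split; [constructor|]. intros; simpl; tauto. Qed.
Lemma expr_mem b i j : expr b (fun M r => r i ∈ r j).
Proof. exists (fMem i j). split; [constructor|]. intros; simpl; tauto. Qed.
Lemma expr_False b : expr b (fun _ _ => False).
Proof. exists (fNot (fEq 0 0)). split; [repeat constructor|]. intros; simpl; tauto. Qed.
Lemma expr_and b (P Q : pred) : expr b P -> expr b Q -> expr b (fun M r => P M r /\ Q M r).
Proof.
  intros [p [Hp H]] [q [Hq H']]. exists (fAnd p q). split; [constructor; auto|].
  intros; simpl; rewrite H, H'; tauto.
Qed.
Lemma expr_or b (P Q : pred) : expr b P -> expr b Q -> expr b (fun M r => P M r \/ Q M r).
Proof.
  intros [p [Hp H]] [q [Hq H']]. exists (fOr p q). split; [constructor; auto|].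
  intros; simpl; rewrite H, H'; tauto.
Qed.
Lemma expr_imp b (P Q : pred) : expr b P -> expr b Q -> expr b (fun M r => P M r -> Q M r).
Proof.
  intros [p [Hp H]] [q [Hq H']]. exists (fImp p q). split; [constructor; auto|].
  intros; simpl; rewrite H, H'; tauto.
Qed.
Lemma expr_ex (P : forall M : structure, (nat -> M) -> M -> Prop) :
  expr false (fun M r => P M (fun n => r (S n)) (r 0)) ->
  expr false (fun M r => exists x, P M r x).
Proof.
  intros [p [Hp H]]. exists (fEx p). split; [discriminate|]. intros M r; simpl.
  split; intros [x Hx]; exists x; apply (H M (scons x r)); auto.
Qed.
Lemma expr_all (P : forall M : structure, (nat -> M) -> M -> Prop) :
  expr false (fun M r => P M (fun n => r (S n)) (r 0)) ->
  expr false (fun M r => forall x, P M r x).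
Proof.
  intros [p [Hp H]]. exists (fAll p). split; [discriminate|]. intros M r; simpl.
  split; intros Hx x; apply (H M (scons x r)); auto; apply Hx.
Qed.
Lemma expr_bex b j (P : forall M : structure, (nat -> M) -> M -> Prop) :
  expr b (fun M r => P M (fun n => r (S n)) (r 0)) ->
  expr b (fun M r => exists x, x ∈ r j /\ P M r x).
Proof.
  intros [p [Hp H]]. exists (fEx (fAnd (fMem 0 (S j)) p)).
  split; [intros; apply D_bex; auto|]. intros M r; simpl.
  split; intros [x [Hj Hx]]; exists x; split; auto; apply (H M (scons x r)); auto.
Qed.
Lemma expr_ball b j (P : forall M : structure, (nat -> M) -> M -> Prop) :
  expr b (fun M r => P M (fun n => r (S n)) (r 0)) ->
  expr b (fun M r => forall x, x ∈ r j -> P M r x).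
Proof.
  intros [p [Hp H]]. exists (fAll (fImp (fMem 0 (S j)) p)).
  split; [intros; apply D_ball; auto|]. intros M r; simpl.
  split; intros Hx x Hj; apply (H M (scons x r)); auto; apply Hx; auto.
Qed.

Ltac express := cbv beta; repeat (first
  [ apply expr_eq | apply expr_mem | apply expr_False | apply expr_bex | apply expr_ball
  | apply expr_ex | apply expr_all
  | apply expr_and | apply expr_or | apply expr_imp ]; cbv beta).

(** The separating formula for [omega], in primitive terms. *)
Lemma expr_omega : expr false (fun M r => forall w,
  ((exists e, e ∈ w /\ forall x, ~ x ∈ e) /\
   (forall n, n ∈ w -> exists s, s ∈ w /\
      forall x, (x ∈ s -> x ∈ n \/ x = n) /\ (x ∈ n \/ x = n -> x ∈ s))) -> r 0 ∈ w).
Proof. express. Qed.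

(** * Elementary set theory *)

Section Basics.
Context {M : structure} (HM : ZFC M).
Implicit Types a b c f n p s t u v w x y z : M.

Lemma expr_sep (P : pred) (r : nat -> M) a : expr false P ->
  exists b, forall x, x ∈ b <-> x ∈ a /\ P M (scons x r).
Proof.
  intros [p [_ Hp]]. destruct (zf_sep M HM p r a) as [b Hb].
  exists b. intros x. rewrite Hp. apply Hb.
Qed.

Lemma empty_exists : exists e : M, forall x, ~ x ∈ e.
Proof. destruct (zf_infinity M HM) as [w [[e [_ He]] _]]. exists e; auto. Qed.

(** The graph of a description is first-order in the describing predicate:
    by extensionality the default value is unique as well. *)
Lemma the_graph (P : M -> Prop) y :
  y = the P <-> unique P y \/ (~ (exists z, unique P z) /\ forall z, ~ z ∈ y).
Proof.
  assert (E : unique P (the P) \/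
              (~ (exists z, unique P z) /\ forall z, ~ z ∈ the P)).
  { unfold the. apply epsilon_spec.
    destruct (classic (exists z, unique P z)) as [[z Hz]|N].
    - exists z; auto.
    - destruct empty_exists as [e He]. exists e; auto. }
  split; [intros ->; exact E|].
  intros [U|[N Hy]]; destruct E as [U'|[N' Hy']].
  - apply U, U'.
  - elim N'; exists y; auto.
  - elim N; eexists; eauto.
  - apply (zf_ext M HM); intros x; split; intros Hx.
    + elim (Hy x Hx).
    + elim (Hy' x Hx).
Qed.

Lemma the_eq (P : M -> Prop) y : unique P y -> the P = y.
Proof. intros H; symmetry; apply the_graph; auto. Qed.

Lemma the_ext (P Q : M -> Prop) : (forall y, P y <-> Q y) -> the P = the Q.
Proof.
  intros H. apply the_graph.
  assert (HU : forall y, unique P y <-> unique Q y).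
  { intros y; unfold unique; split; intros [h h']; split; try apply H; auto;
      intros z Hz; apply h', H, Hz. }
  destruct (proj1 (the_graph P (the P)) eq_refl) as [U|[N Hy]].
  - left; apply HU, U.
  - right; split; auto. intros [z Hz]; apply N; exists z; apply HU, Hz.
Qed.

Lemma the_cases (P : M -> Prop) : P (the P) \/ forall z, ~ z ∈ the P.
Proof. destruct (proj1 (the_graph P (the P)) eq_refl) as [[h _]|[_ h]]; auto. Qed.

(** This direction holds even when the class is not a set, as the default
    value has no members; so bounds on members never require existence. *)
Lemma in_cls (P : M -> Prop) x : x ∈ cls P -> P x.
Proof.
  intros Hx. destruct (the_cases (fun y => forall x, x ∈ y <-> P x)) as [H|H].
  - apply H, Hx.
  - elim (H x Hx).
Qed.

Lemma cls_spec (P : M -> Prop) :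
  (exists y, forall x, x ∈ y <-> P x) -> forall x, x ∈ cls P <-> P x.
Proof.
  intros [y Hy]. assert (E : cls P = y).
  { apply the_eq. split; auto. intros z Hz. apply (zf_ext M HM).
    intros x; rewrite Hy, Hz; tauto. }
  rewrite E; exact Hy.
Qed.

Lemma cls_ext (P Q : M -> Prop) : (forall x, P x <-> Q x) -> cls P = cls Q.
Proof.
  intros H; apply the_ext; intros y; split; intros Hy x; rewrite Hy, H; tauto.
Qed.

Lemma in_empty x : ~ x ∈ empty.
Proof. exact (in_cls _ x). Qed.

Lemma empty_eq e : (forall x, ~ x ∈ e) -> e = empty.
Proof.
  intros H; apply (zf_ext M HM); intros x; split; intros Hx;
    [elim (H x Hx)|elim (in_empty x Hx)].
Qed.

Lemma the_or_empty (P : M -> Prop) : P (the P) \/ the P = empty.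
Proof. destruct (the_cases P); auto using empty_eq. Qed.

Lemma in_upair a b x : x ∈ upair a b <-> x = a \/ x = b.
Proof. apply (cls_spec (fun x => x = a \/ x = b)), (zf_pair M HM). Qed.

Lemma in_sing a x : x ∈ sing a <-> x = a.
Proof.
  apply (cls_spec (fun x => x = a)). destruct (zf_pair M HM a a) as [c Hc].
  exists c; intros y; rewrite Hc; tauto.
Qed.

Lemma in_succ n x : x ∈ succ n <-> x ∈ n \/ x = n.
Proof.
  apply (cls_spec (fun x => x ∈ n \/ x = n)). destruct (zf_union M HM (upair n (sing n))) as [c Hc].
  exists c; intros y; rewrite Hc; split.
  - intros [z [Hz Hy]]. apply in_upair in Hz as [->| ->]; auto.
    apply in_sing in Hy; auto.
  - intros [H| ->]; [exists n|exists (sing n)]; rewrite in_upair; auto.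
    rewrite in_sing; auto.
Qed.

Lemma sing_inj a b : sing a = sing b -> a = b.
Proof. intros H. apply in_sing. rewrite <- H. apply in_sing; auto. Qed.

Lemma upair_inj a b c : upair a b = upair a c -> b = c.
Proof.
  intros H.
  assert (Hb : b ∈ upair a c) by (rewrite <- H; apply in_upair; auto).
  assert (Hc : c ∈ upair a b) by (rewrite H; apply in_upair; auto).
  apply in_upair in Hb, Hc. intuition congruence.
Qed.

Lemma opair_inj a b a' b' : opair a b = opair a' b' -> a = a' /\ b = b'.
Proof.
  intros H. unfold opair in H.
  assert (E : a = a').
  { assert (Ha : sing a ∈ upair (sing a') (upair a' b'))
      by (rewrite <- H; apply in_upair; auto).
    apply in_upair in Ha as [Ha|Ha]; [apply sing_inj, Ha|].
    symmetry; apply in_sing; rewrite Ha; apply in_upair; auto. }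
  subst a'. split; auto.
  apply upair_inj in H. apply upair_inj in H. exact H.
Qed.

Lemma pi1_opair a b : pi1 (opair a b) = a.
Proof.
  apply the_eq; split; [exists b; auto|].
  intros c [d Hd]; apply opair_inj in Hd; tauto.
Qed.

Lemma pi2_opair a b : pi2 (opair a b) = b.
Proof.
  apply the_eq; split; [exists a; auto|].
  intros c [d Hd]; apply opair_inj in Hd; tauto.
Qed.

(** Pairs in primitive terms, for use in instances of the axiom schemes. *)
Lemma opair_graph p x y : p = opair x y <->
  forall z, z ∈ p <-> (forall w, w ∈ z <-> w = x) \/ (forall w, w ∈ z <-> w = x \/ w = y).
Proof.
  assert (E : forall z, z ∈ opair x y <->
            (forall w, w ∈ z <-> w = x) \/ (forall w, w ∈ z <-> w = x \/ w = y)).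
  { intros z. unfold opair. rewrite in_upair. split.
    - intros [->| ->]; [left|right]; intros w; [apply in_sing|apply in_upair].
    - intros [H|H]; [left|right]; apply (zf_ext M HM); intros w; rewrite H;
        rewrite ?in_sing, ?in_upair; tauto. }
  split; [intros ->; exact E|].
  intros H; apply (zf_ext M HM); intros z; rewrite H, E; tauto.
Qed.

Lemma app_in f x : opair x (app f x) ∈ f \/ app f x = empty.
Proof. exact (the_or_empty (fun y => opair x y ∈ f)). Qed.

Lemma app_eq f a x y : func f a -> opair x y ∈ f -> app f x = y.
Proof.
  intros [Hp Hx] H. apply the_eq.
  destruct (Hp _ H) as [x' [y' [Hx' E]]]. apply opair_inj in E as [<- <-].
  destruct (Hx x Hx') as [y' [H1 H2]].
  split; auto. intros z Hz. rewrite <- (H2 _ H); apply H2, Hz.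
Qed.

Lemma func_elem f a p : func f a -> p ∈ f -> exists x, x ∈ a /\ p = opair x (app f x).
Proof.
  intros Hf Hp. destruct (proj1 Hf p Hp) as [x [y [Hx ->]]].
  exists x. rewrite (app_eq f a x y); auto.
Qed.

Lemma in_lam a (F : M -> M) p : p ∈ lam a F -> exists x, x ∈ a /\ p = opair x (F x).
Proof. exact (in_cls _ p). Qed.

(** ** Natural numbers *)

Lemma omega_exists : exists o : M, forall n, n ∈ o <-> (forall w, inductive w -> n ∈ w).
Proof.
  destruct (zf_infinity M HM) as [w [[e [He He']] Hw]].
  assert (I : forall w, inductive w <->
     ((exists e, e ∈ w /\ forall x, ~ x ∈ e) /\
      (forall n, n ∈ w -> exists s, s ∈ w /\ forall x, x ∈ s <-> x ∈ n \/ x = n))).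
  { clear w e He He' Hw; intros w; unfold inductive; split.
    - intros [H H']; split.
      + exists empty; split; auto. apply in_empty.
      + intros n Hn; exists (succ n); split; auto. apply in_succ.
    - intros [[e [He He']] H']; split.
      + rewrite <- (empty_eq e); auto.
      + intros n Hn. destruct (H' n Hn) as [s [Hs E]].
        replace (succ n) with s; auto.
        apply (zf_ext M HM); intros x; rewrite E, in_succ; tauto. }
  destruct (expr_sep _ (fun _ => w) w expr_omega) as [o Ho].
  exists o. intros n. rewrite Ho. simpl. split.
  - intros [_ H] v Hv. apply H, I, Hv.
  - intros H; split.
    + apply H, I; split; eauto.
    + intros v Hv. apply H, I, Hv.
Qed.

Lemma in_omega n : n ∈ omega <-> forall w, inductive w -> n ∈ w.
Proof. apply (cls_spec (fun n => forall w, inductive w -> n ∈ w)), omega_exists. Qed.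

Lemma omega_inductive : inductive (omega : M).
Proof.
  split.
  - apply in_omega. intros w [H _]; exact H.
  - intros n Hn. apply in_omega. intros w Hw. apply Hw.
    exact (proj1 (in_omega n) Hn w Hw).
Qed.

Lemma omega_ind b : empty ∈ b -> (forall n, n ∈ omega -> n ∈ b -> succ n ∈ b) ->
  (forall x, x ∈ b -> x ∈ omega) -> forall n, n ∈ omega -> n ∈ b.
Proof.
  intros H0 HS Hb n Hn. rewrite in_omega in Hn. apply Hn. split; auto.
Qed.

Lemma succ_inj m n : succ m = succ n -> m = n.
Proof.
  intros H. destruct (classic (m = n)) as [|N]; auto. exfalso.
  assert (Hm : m ∈ n).
  { assert (h : m ∈ succ n) by (rewrite <- H; apply in_succ; auto).
    apply in_succ in h; tauto. }
  assert (Hn : n ∈ m).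
  { assert (h : n ∈ succ m) by (rewrite H; apply in_succ; auto).
    apply in_succ in h; intuition congruence. }
  destruct (zf_found M HM (upair m n)) as [x [Hx Hy]].
  { exists m; apply in_upair; auto. }
  apply in_upair in Hx as [->| ->].
  - apply (Hy n); auto; apply in_upair; auto.
  - apply (Hy m); auto; apply in_upair; auto.
Qed.

Lemma succ_nonempty n : succ n <> empty.
Proof. intros H. apply (in_empty n). rewrite <- H. apply in_succ; auto. Qed.

End Basics.

(** * Universes *)

(** One step of the construction of a universe. *)
Definition grow {M : structure} (x : M) : M :=
  ⦃ z | z ∈ x \/ (exists u, u ∈ x /\ z ∈ u) \/ subset z x ⦄.

(** In [univ_grow], [a] is adjoined at the same time, so that finitely many
    members of a universe always lie in a single one. *)
Record universe {M : structure} (U : M) : Prop := {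
  univ_trans : forall x y, x ∈ U -> y ∈ x -> y ∈ U;
  univ_subset : forall x z, x ∈ U -> subset z x -> z ∈ U;
  univ_grow : forall x a, x ∈ U -> a ∈ U -> exists y, y ∈ U /\ a ∈ y /\ subset (grow x) y;
  univ_inhabited : exists x, x ∈ U
}.

(** [y = grow x] and [p = opair x y] in primitive terms, for use in instances
    of the axiom schemes. *)
Notation is_grow y x := (forall z, z ∈ y <->
  z ∈ x \/ (exists u, u ∈ x /\ z ∈ u) \/ (forall v, v ∈ z -> v ∈ x)).
Notation is_opair p x y := (forall z, z ∈ p <->
  (forall w, w ∈ z <-> w = x) \/ (forall w, w ∈ z <-> w = x \/ w = y)).

(** [y] is the iterate of index [j] of [grow] at [a], witnessed by a set of
    pairs (index, iterate) closed under predecessors. *)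
Notation is_iterate a j y := (exists t,
  (forall p, p ∈ t -> (exists e, (forall x, ~ x ∈ e) /\ is_opair p e a) \/
     (exists k z q s g, is_opair q k z /\ q ∈ t /\
        (forall x, x ∈ s <-> x ∈ k \/ x = k) /\ is_grow g z /\ is_opair p s g)) /\
  exists q, is_opair q j y /\ q ∈ t).

Lemma expr_is_iterate i j k : expr false (fun M r => is_iterate (r i) (r j) (r k)).
Proof. express. Qed.

Section Universe.
Context {M : structure} (HM : ZFC M).
Implicit Types a b f n p s t u v w x y z U : M.

Lemma in_grow x z : z ∈ grow x <-> z ∈ x \/ (exists u, u ∈ x /\ z ∈ u) \/ subset z x.
Proof.
  apply (cls_spec HM (fun z => z ∈ x \/ (exists u, u ∈ x /\ z ∈ u) \/ subset z x)).
  destruct (zf_union M HM x) as [u Hu], (zf_power M HM x) as [v Hv].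
  destruct (zf_union M HM (upair u v)) as [g Hg].
  destruct (zf_union M HM (upair x g)) as [h Hh].
  exists h. intros y. rewrite Hh. split.
  - intros [w [Hw Hy]]. apply (in_upair HM) in Hw as [->| ->]; auto.
    apply Hg in Hy as [w [Hw Hy]]. apply (in_upair HM) in Hw as [->| ->].
    + apply Hu in Hy; auto.
    + right; right; exact (proj1 (Hv y) Hy).
  - intros [H|[H|H]].
    + exists x. rewrite (in_upair HM); auto.
    + exists g. rewrite (in_upair HM), Hg. split; auto. exists u.
      rewrite (in_upair HM), Hu; auto.
    + exists g. rewrite (in_upair HM), Hg. split; auto. exists v.
      rewrite (in_upair HM), Hv; auto.
Qed.

Lemma grow_graph x y : y = grow x <-> is_grow y x.
Proof.
  split; [intros -> z; apply in_grow|].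
  intros H; apply (zf_ext M HM); intros z; rewrite H, in_grow; tauto.
Qed.

Lemma is_iterate_spec a j y : is_iterate a j y <-> exists t,
  (forall p, p ∈ t -> p = opair empty a \/
     (exists k z, opair k z ∈ t /\ p = opair (succ k) (grow z))) /\
  opair j y ∈ t.
Proof.
  split.
  - intros [t [Ht [q [Hq Hqt]]]]. exists t. apply (opair_graph HM) in Hq as ->.
    split; auto. intros p Hp. destruct (Ht p Hp) as [[e [He H]]|H].
    + left. apply (opair_graph HM) in H as ->. rewrite (empty_eq HM e); auto.
    + right. destruct H as [k [z [q [s [g [Hq [Hq' [Hs [Hg H]]]]]]]]].
      apply (opair_graph HM) in Hq as ->. apply (opair_graph HM) in H as ->.
      apply grow_graph in Hg as ->.
      replace s with (succ k) by (apply (zf_ext M HM); intros x; rewrite Hs, (in_succ HM); tauto).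
      eauto.
  - intros [t [Ht H]]. exists t. split.
    + intros p Hp. destruct (Ht p Hp) as [->|[k [z [Hk ->]]]].
      * left; exists empty. split; [apply (in_empty HM)|apply (opair_graph HM); auto].
      * right. exists k, z, (opair k z), (succ k), (grow z).
        repeat split; auto; try (apply (opair_graph HM); auto); try apply (in_succ HM);
          try apply in_grow; intros h; apply (in_succ HM); auto.
    + exists (opair j y); split; auto. apply (opair_graph HM); auto.
Qed.

Lemma iterate_zero a y : is_iterate a empty y <-> y = a.
Proof.
  rewrite is_iterate_spec. split.
  - intros [t [Ht H]]. destruct (Ht _ H) as [E|[k [z [_ E]]]];
      apply (opair_inj HM) in E as [E1 E2]; auto.
    elim (succ_nonempty HM k); auto.
  - intros ->. exists (sing (opair empty a)). split.
    + intros p Hp; apply (in_sing HM) in Hp; auto.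
    + apply (in_sing HM); auto.
Qed.

Lemma iterate_succ a j y :
  is_iterate a (succ j) y <-> exists z, is_iterate a j z /\ y = grow z.
Proof.
  split.
  - intros H; apply is_iterate_spec in H as [t [Ht H]].
    destruct (Ht _ H) as [E|[k [z [Hk E]]]]; apply (opair_inj HM) in E as [E1 E2].
    + elim (succ_nonempty HM j); auto.
    + apply (succ_inj HM) in E1 as <-. exists z; split; auto.
      apply is_iterate_spec; eauto.
  - intros [z [H ->]]. apply is_iterate_spec in H as [t [Ht H]].
    apply is_iterate_spec.
    destruct (zf_union M HM (upair t (sing (opair (succ j) (grow z))))) as [c Hc].
    assert (E : forall p, p ∈ c <-> p ∈ t \/ p = opair (succ j) (grow z)).
    { intros p; rewrite Hc; split.
      - intros [w [Hw Hp]]. apply (in_upair HM) in Hw as [->| ->]; auto.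
        apply (in_sing HM) in Hp; auto.
      - intros [Hp| ->]; [exists t|exists (sing (opair (succ j) (grow z)))];
          rewrite (in_upair HM), ?(in_sing HM); auto. }
    exists c. split.
    + intros p Hp. apply E in Hp as [Hp| ->].
      * destruct (Ht p Hp) as [->|[k [u [Hk ->]]]]; auto.
        right; exists k, u; rewrite E; auto.
      * right; exists j, z; rewrite E; auto.
    + apply E; auto.
Qed.

(** The last clause is induction along the iterates; it spares the indices in
    what follows. *)
Lemma iterates a : exists s, a ∈ s /\ (forall y, y ∈ s -> grow y ∈ s) /\
  forall t, a ∈ t -> (forall y, y ∈ s -> y ∈ t -> grow y ∈ t) ->
    forall y, y ∈ s -> y ∈ t.
Proof.
  assert (Huniq : forall j, j ∈ omega ->
            forall y z, is_iterate a j y -> is_iterate a j z -> y = z).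
  { destruct (expr_sep HM (fun M r => forall y z : M,
      is_iterate (r 1) (r 0) y -> is_iterate (r 1) (r 0) z -> y = z)
      (fun _ => a) omega) as [b Hb]; [express|]. cbn -[omega] in Hb.
    intros j Hj. apply Hb. apply (omega_ind HM); auto; [| |intros x Hx; apply Hb, Hx].
    - apply Hb. split; [apply (omega_inductive HM)|].
      intros y z Hy Hz. apply iterate_zero in Hy, Hz. congruence.
    - intros n Hn Hn'. apply Hb. split; [apply (omega_inductive HM), Hn|].
      intros y z Hy Hz. apply iterate_succ in Hy as [y' [Hy ->]], Hz as [z' [Hz ->]].
      f_equal. apply Hb in Hn'. apply Hn'; auto. }
  destruct (expr_is_iterate 2 1 0) as [q [_ Hq]].
  destruct (zf_repl M HM q (fun _ => a) omega) as [s Hs].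
  { intros j y z Hj Hy Hz. apply Hq in Hy, Hz. exact (Huniq j Hj y z Hy Hz). }
  assert (E : forall y, y ∈ s <-> exists j, j ∈ omega /\ is_iterate a j y).
  { intros y; rewrite Hs; split; intros [j [Hj H]]; exists j; split; auto;
      apply (Hq M (scons y (scons j (fun _ => a)))), H. }
  clear q Hq Hs. exists s. split; [|split].
  - apply E. exists empty; split; [apply (omega_inductive HM)|apply iterate_zero; auto].
  - intros y Hy; apply E in Hy as [j [Hj Hy]]. apply E. exists (succ j).
    split; [apply (omega_inductive HM), Hj|]. apply iterate_succ; eauto.
  - intros t Ha Ht.
    destruct (expr_sep HM (fun M r => forall y : M, is_iterate (r 1) (r 0) y -> y ∈ r 2)
      (scons a (fun _ => t)) omega) as [b Hb]; [express|]. cbn -[omega] in Hb.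
    intros y Hy. apply E in Hy as [j [Hj Hy]]. revert y Hy. apply Hb.
    apply (omega_ind HM); auto; [| |intros x Hx; apply Hb, Hx].
    + apply Hb. split; [apply (omega_inductive HM)|].
      intros y Hy. apply iterate_zero in Hy as ->; auto.
    + intros n Hn Hn'. apply Hb. split; [apply (omega_inductive HM), Hn|].
      intros y Hy. apply iterate_succ in Hy as [z [Hz ->]].
      apply Ht; [apply E; eauto|]. apply Hb in Hn'. apply Hn'; auto.
Qed.

Lemma grow_mono x y : subset x y -> subset (grow x) (grow y).
Proof.
  intros H z. rewrite !in_grow. intros [h|[[u [hu h]]|h]]; [left|right; left|right; right]; auto.
  - exists u; auto.
  - intros v hv; auto.
Qed.

Lemma subset_grow x : subset x (grow x).
Proof. intros z Hz; apply in_grow; auto. Qed.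

(** The union of the iterates of [grow] at [a].  The iterates need not be
    transitive, but the next one contains the members of the members, the one
    after it contains the subsets of the members, and any two iterates are
    contained in a third. *)
Lemma exists_universe a : exists U, universe U /\ subset a U.
Proof.
  destruct (iterates a) as [s [Ha [Hg Hind]]].
  assert (Hsub : forall x, x ∈ s -> subset a x).
  { destruct (expr_sep HM (fun M r => forall v : M, v ∈ r 1 -> v ∈ r 0)
      (fun _ => a) s) as [b Hb]; [express|]. cbn in Hb.
    intros x Hx. enough (h : x ∈ b) by exact (proj2 (proj1 (Hb x) h)).
    apply Hind; auto; rewrite ?Hb; auto.
    intros y Hy Hy'. apply Hb in Hy'. apply Hb. split; auto.
    intros v Hv. apply subset_grow, Hy', Hv. }
  assert (Hdir : forall x y, x ∈ s -> y ∈ s -> exists z, z ∈ s /\ subset x z /\ subset y z).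
  { intros x y Hx Hy.
    destruct (expr_sep HM (fun M r => exists z : M, z ∈ r 1 /\ (forall v : M, v ∈ r 2 -> v ∈ z) /\
      (forall v : M, v ∈ r 0 -> v ∈ z)) (scons s (fun _ => x)) s) as [b Hb]; [express|].
    cbn in Hb. enough (h : y ∈ b) by exact (proj2 (proj1 (Hb y) h)). apply Hind; auto.
    - apply Hb. split; auto. exists x; repeat split; auto. apply Hsub; auto.
    - intros z Hz Hz'. apply Hb in Hz' as [_ [w [Hw [h1 h2]]]]. apply Hb. split; auto.
      exists (grow w). repeat split; auto.
      + intros v Hv; apply subset_grow; auto.
      + apply grow_mono; auto. }
  destruct (zf_union M HM s) as [U HU]. exists U. split; [split|].
  - intros x y Hx Hy. apply HU in Hx as [z [Hz Hx]]. apply HU.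
    exists (grow z). split; auto. apply in_grow; eauto.
  - intros x y Hx Hy. apply HU in Hx as [z [Hz Hx]]. apply HU.
    exists (grow (grow z)). split; auto. apply in_grow. right; right.
    intros v Hv. apply in_grow. right; left. exists x; auto.
  - intros x y Hx Hy. apply HU in Hx as [z [Hz Hx]], Hy as [w [Hw Hy]].
    destruct (Hdir z w Hz Hw) as [k [Hk [h1 h2]]].
    exists (grow (grow k)). split; [|split].
    + apply HU. exists (grow (grow (grow k))). split; auto. apply in_grow.
      right; right; intros v; auto.
    + do 2 apply subset_grow. auto.
    + apply grow_mono. intros v Hv. apply in_grow. right; left. exists x; auto.
  - exists a. apply HU. exists (grow a). split; auto. apply in_grow. right; right; intros v; auto.
  - intros x Hx. apply HU; eauto.
Qed.

End Universe.

(** * Local predicates and terms *)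

Fixpoint level {M : structure} (c : nat) (A : M) : M :=
  match c with 0 => A | S c' => grow (level c' A) end.

Section Levels.
Context {M : structure} (HM : ZFC M).
Implicit Types x y z A B U W : M.

Lemma level_mono c d A : c <= d -> subset (level c A) (level d A).
Proof.
  induction 1 as [|d _ IH]; [intros x; auto|].
  intros x Hx. apply (subset_grow HM), IH, Hx.
Qed.

Lemma level_add c d A : level c (level d A) = level (c + d) A.
Proof. induction c as [|c IH]; simpl; congruence. Qed.

Lemma level_elem c A x y : y ∈ level c A -> x ∈ y -> x ∈ level (S c) A.
Proof. intros Hy Hx. apply (in_grow HM). right; left; eauto. Qed.

Lemma level_part c A x : subset x (level c A) -> x ∈ level (S c) A.
Proof. intros Hx. apply (in_grow HM). right; right; exact Hx. Qed.

Lemma universe_grow U x : universe U -> x ∈ U -> grow x ∈ U.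
Proof.
  intros HU Hx. destruct (univ_grow U HU x x Hx Hx) as [y [Hy [_ H]]].
  apply (univ_subset U HU y); auto.
Qed.

Lemma universe_level U c A : universe U -> A ∈ U -> level c A ∈ U.
Proof. intros HU HA. induction c; simpl; auto using universe_grow. Qed.

Lemma universe_subset_level U c A : universe U -> A ∈ U -> subset (level c A) U.
Proof.
  intros HU HA x Hx. apply (univ_trans U HU (level c A)); auto. apply universe_level; auto.
Qed.

(** [A] contains all the values of [r], and a universe, which provides the
    natural numbers and plays the role of the set of hereditarily finite sets. *)
Definition framed A (r : nat -> M) : Prop :=
  (exists W, W ∈ A /\ universe W) /\ forall n, r n ∈ A.

Lemma framed_scons A B (r : nat -> M) x :
  framed A r -> subset A B -> x ∈ B -> framed B (scons x r).
Proof.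
  intros [[W [HW HW']] Hr] HA Hx. split; [exists W; auto|]. intros [|n]; simpl; auto.
Qed.

Lemma framed_scons_level c A (r : nat -> M) x :
  framed A r -> x ∈ level c A -> framed (level c A) (scons x r).
Proof. intros H Hx. apply (framed_scons A); auto. apply (level_mono 0); lia. Qed.

Lemma framed_ren A (r : nat -> M) f : framed A r -> framed A (fun n => r (f n)).
Proof. intros [H H']; split; auto. Qed.

(** This is what allows to extend the assignment under a quantifier. *)
Lemma universe_extend U A (r : nat -> M) x : universe U -> A ∈ U -> framed A r -> x ∈ U ->
  exists B, B ∈ U /\ framed B (scons x r).
Proof.
  intros HU HA Hr Hx. destruct (univ_grow U HU A x HA Hx) as [B [HB [Hx' H]]].
  exists B; split; auto. apply (framed_scons A); auto.
  intros z Hz; apply H, (subset_grow HM), Hz.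
Qed.

Lemma universe_omega W : universe W -> subset omega W.
Proof.
  intros HW. assert (HI : inductive W).
  { destruct (univ_inhabited W HW) as [x Hx]. split.
    - apply (univ_subset W HW x); auto. intros y Hy; elim (in_empty HM y Hy).
    - intros n Hn. destruct (univ_grow W HW n n Hn Hn) as [y [Hy [Hn' H]]].
      apply (univ_subset W HW y); auto. intros m Hm.
      apply (in_succ HM) in Hm as [Hm| ->]; auto. apply H, (subset_grow HM), Hm. }
  intros n Hn. exact (proj1 (in_omega HM n) Hn W HI).
Qed.

End Levels.

(** One formula, whose relativisation defines [P] in every universe.  The
    assignment takes its values in a member [A] of the universe, not just in the
    universe itself, so that [bounded] terms have values in the universe. *)
Definition local (P : pred) : Prop := exists p, forall M : structure, ZFC M ->
  forall (U A : M) r, universe U -> A ∈ U -> framed A r -> (P M r <-> satU U r p).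

Definition bounded (T : term) : Prop := exists c, forall M : structure, ZFC M ->
  forall (A : M) r, framed A r -> T M r ∈ level c A.

Definition localT (T : term) : Prop :=
  bounded T /\ local (fun M r => r 0 = T M (fun n => r (S n))).

Definition bd (P : forall M : structure, (nat -> M) -> M -> Prop) : Prop :=
  exists c, forall M : structure, ZFC M ->
  forall (A : M) r, framed A r -> forall x, P M r x -> x ∈ level c A.

(** The numbered variants are for predicates and functions of that many
    arguments besides the assignment; the arguments become the first variables. *)
Notation local1 P := (local (fun M r => P M (fun n => r (S n)) (r 0))).
Notation localT1 F := (localT (fun M r => F M (fun n => r (S n)) (r 0))).
Notation local2 P := (local (fun M r => P M (fun n => r (S (S n))) (r 1) (r 0))).
Notation localT2 F := (localT (fun M r => F M (fun n => r (S (S n))) (r 1) (r 0))).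
Notation localT4 F :=
  (localT (fun M r => F M (fun n => r (S (S (S (S n))))) (r 3) (r 2) (r 1) (r 0))).

Lemma local_iff (P Q : pred) :
  (forall M : structure, ZFC M -> forall r, P M r <-> Q M r) -> local Q -> local P.
Proof.
  intros E [p Hp]. exists p. intros M HM U A r HU HA Hr. rewrite E; eauto.
Qed.

Lemma localT_ext (S T : term) :
  (forall M : structure, ZFC M -> forall r, S M r = T M r) -> localT T -> localT S.
Proof.
  intros E [[c Hc] H]. split.
  - exists c. intros M HM A r Hr. rewrite E; auto.
  - eapply local_iff; [|exact H]. intros M HM r. simpl. rewrite E; tauto.
Qed.

(** ** Connectives, renaming and substitution *)

Lemma local_not (P : pred) : local P -> local (fun M r => ~ P M r).
Proof.
  intros [p Hp]. exists (fNot p). intros M HM U A r HU HA Hr; simpl.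
  rewrite (Hp M HM U A r); tauto.
Qed.
Lemma local_and (P Q : pred) : local P -> local Q -> local (fun M r => P M r /\ Q M r).
Proof.
  intros [p Hp] [q Hq]. exists (fAnd p q). intros M HM U A r HU HA Hr; simpl.
  rewrite (Hp M HM U A r), (Hq M HM U A r); tauto.
Qed.
Lemma local_or (P Q : pred) : local P -> local Q -> local (fun M r => P M r \/ Q M r).
Proof.
  intros [p Hp] [q Hq]. exists (fOr p q). intros M HM U A r HU HA Hr; simpl.
  rewrite (Hp M HM U A r), (Hq M HM U A r); tauto.
Qed.
Lemma local_imp (P Q : pred) : local P -> local Q -> local (fun M r => P M r -> Q M r).
Proof.
  intros [p Hp] [q Hq]. exists (fImp p q). intros M HM U A r HU HA Hr; simpl.
  rewrite (Hp M HM U A r), (Hq M HM U A r); tauto.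
Qed.
Lemma local_False : local (fun _ _ => False).
Proof. exists (fNot (fEq 0 0)). intros; simpl; tauto. Qed.

Lemma local_ex (P : forall M : structure, (nat -> M) -> M -> Prop) :
  local1 P -> bd P -> local (fun M r => exists x, P M r x).
Proof.
  intros [p Hp] [c Hc]. exists (fEx p). intros M HM U A r HU HA Hr; simpl.
  assert (H : forall x, x ∈ U -> (P M r x <-> satU U (scons x r) p)).
  { intros x Hx. destruct (universe_extend HM U A r x) as [B [HB HB']]; auto.
    apply (Hp M HM U B (scons x r)); auto. }
  split.
  - intros [x Hx]. assert (x ∈ U) by (apply (universe_subset_level U c A); eauto).
    exists x; split; auto. apply H; auto.
  - intros [x [HxU Hx]]. exists x. apply H; auto.
Qed.

Lemma local_all (P : forall M : structure, (nat -> M) -> M -> Prop) :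
  local1 P -> bd (fun M r x => ~ P M r x) -> local (fun M r => forall x, P M r x).
Proof.
  intros H1 H2. apply local_iff with (Q := fun M r => ~ exists x, ~ P M r x).
  - intros M _ r. split; [intros H [x Hx]; auto|].
    intros H x. apply NNPP. intros N; eauto.
  - apply local_not, local_ex; auto. apply (local_not (fun M r => P M _ (r 0))); auto.
Qed.

Lemma local_ren (P : pred) f : local P -> local (fun M r => P M (fun n => r (f n))).
Proof.
  intros [p Hp]. exists (ren f p). intros M HM U A r HU HA Hr.
  rewrite (satU_ren U p f (fun n => r (f n))); auto.
  apply (Hp M HM U A); auto. apply framed_ren; auto.
Qed.

Lemma bounded_ren (T : term) f : bounded T -> bounded (fun M r => T M (fun n => r (f n))).
Proof.
  intros [c Hc]. exists c. intros M HM A r Hr. apply Hc; auto. apply framed_ren; auto.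
Qed.

Lemma localT_ren (T : term) f : localT T -> localT (fun M r => T M (fun n => r (f n))).
Proof.
  intros [H1 H2]. split; [apply bounded_ren, H1|]. exact (local_ren _ (up_ren f) H2).
Qed.

Lemma bounded_in_universe (T : term) : bounded T -> forall M : structure, ZFC M ->
  forall (U A : M) r, universe U -> A ∈ U -> framed A r -> T M r ∈ U.
Proof.
  intros [c Hc] M HM U A r HU HA Hr. apply (universe_subset_level U c A); auto.
Qed.

Lemma bounded_subst (F : forall M : structure, (nat -> M) -> M -> M) (T : term) :
  bounded (fun M r => F M (fun n => r (S n)) (r 0)) -> bounded T ->
  bounded (fun M r => F M r (T M r)).
Proof.
  intros [c Hc] [d Hd]. exists (c + d). intros M HM A r Hr.
  rewrite <- level_add. apply (Hc M HM _ (scons (T M r) r)).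
  apply framed_scons_level; auto.
Qed.

(** A term has no counterpart among formulas, so its value is quantified over:
    it lies in the universe because the term is bounded. *)
Lemma local_subst (P : forall M : structure, (nat -> M) -> M -> Prop) (T : term) :
  localT T -> local1 P -> local (fun M r => P M r (T M r)).
Proof.
  intros [HT [q Hq]] [p Hp]. exists (fEx (fAnd q p)). intros M HM U A r HU HA Hr; simpl.
  assert (H : forall x, x ∈ U -> (P M r x <-> satU U (scons x r) p) /\
                        (x = T M r <-> satU U (scons x r) q)).
  { intros x Hx. destruct (universe_extend HM U A r x) as [B [HB HB']]; auto.
    split; [apply (Hp M HM U B (scons x r))|apply (Hq M HM U B (scons x r))]; auto. }
  split.
  - intros HP. assert (HU' : T M r ∈ U) by (eapply bounded_in_universe; eauto).
    exists (T M r). split; auto. split; apply H; auto.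
  - intros [x [Hx [H1 H2]]]. apply H in H1, H2; auto. subst x; auto.
Qed.

Lemma localT_subst (F : forall M : structure, (nat -> M) -> M -> M) (T : term) :
  localT1 F -> localT T -> localT (fun M r => F M r (T M r)).
Proof.
  intros [HF HF'] HT. split; [apply bounded_subst; auto; apply HT|].
  apply (local_subst (fun M r x => r 0 = F M (fun n => r (S n)) x)
           (fun M r => T M (fun n => r (S n)))).
  - apply localT_ren, HT.
  - exact (local_ren _ (fun n => match n with 0 => 1 | 1 => 0 | S (S k) => S (S k) end) HF').
Qed.

Lemma localT_var i : localT (fun M r => r i).
Proof.
  split.
  - exists 0. intros M HM A r [_ Hr]; apply Hr.
  - exists (fEq 0 (S i)). intros; simpl; tauto.
Qed.

Lemma local_eq (S T : term) : localT S -> localT T -> local (fun M r => S M r = T M r).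
Proof.
  intros HS HT. apply (local_subst (fun M r x => S M r = x) T); auto.
  apply (local_subst (fun M r x => x = r 0) (fun M r => S M (fun n => r (Datatypes.S n)))).
  - apply localT_ren, HS.
  - exists (fEq 0 1). intros; simpl; tauto.
Qed.

Lemma local_mem (S T : term) : localT S -> localT T -> local (fun M r => S M r ∈ T M r).
Proof.
  intros HS HT. apply (local_subst (fun M r x => S M r ∈ x) T); auto.
  apply (local_subst (fun M r x => x ∈ r 0) (fun M r => S M (fun n => r (Datatypes.S n)))).
  - apply localT_ren, HS.
  - exists (fMem 0 1). intros; simpl; tauto.
Qed.

(** ** Instances of functions and predicates given by abstraction *)

Lemma localT_app1 (F : forall M : structure, (nat -> M) -> M -> M) f (T : term) :
  localT1 F -> localT T -> localT (fun M r => F M (fun n => r (f n)) (T M r)).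
Proof.
  intros HF HT. apply (localT_subst (fun M r x => F M (fun n => r (f n)) x) T); auto.
  exact (localT_ren _ (up_ren f) HF).
Qed.

Lemma local_app1 (P : forall M : structure, (nat -> M) -> M -> Prop) f (T : term) :
  local1 P -> localT T -> local (fun M r => P M (fun n => r (f n)) (T M r)).
Proof.
  intros HF HT. apply (local_subst (fun M r x => P M (fun n => r (f n)) x) T); auto.
  exact (local_ren _ (up_ren f) HF).
Qed.

Lemma localT_app2 (F : forall M : structure, (nat -> M) -> M -> M -> M) f (T1 T2 : term) :
  localT2 F -> localT T1 -> localT T2 ->
  localT (fun M r => F M (fun n => r (f n)) (T1 M r) (T2 M r)).
Proof.
  intros HF H1 H2.
  apply (localT_subst (fun M r x => F M (fun n => r (f n)) x (T2 M r)) T1); auto.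
  apply (localT_subst (fun M r x => F M (fun n => r (S (f n))) (r 0) x)
           (fun M r => T2 M (fun n => r (S n)))); [|apply localT_ren; auto].
  exact (localT_ren _ (up_ren (up_ren f)) HF).
Qed.

Lemma local_app2 (P : forall M : structure, (nat -> M) -> M -> M -> Prop) f (T1 T2 : term) :
  local2 P -> localT T1 -> localT T2 ->
  local (fun M r => P M (fun n => r (f n)) (T1 M r) (T2 M r)).
Proof.
  intros HF H1 H2.
  apply (local_subst (fun M r x => P M (fun n => r (f n)) x (T2 M r)) T1); auto.
  apply (local_subst (fun M r x => P M (fun n => r (S (f n))) (r 0) x)
           (fun M r => T2 M (fun n => r (S n)))); [apply localT_ren; auto|].
  exact (local_ren _ (up_ren (up_ren f)) HF).
Qed.

Lemma localT_app4 (F : forall M : structure, (nat -> M) -> M -> M -> M -> M -> M) f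
  (T1 T2 T3 T4 : term) :
  localT4 F -> localT T1 -> localT T2 -> localT T3 -> localT T4 ->
  localT (fun M r => F M (fun n => r (f n)) (T1 M r) (T2 M r) (T3 M r) (T4 M r)).
Proof.
  intros HF H1 H2 H3 H4.
  apply (localT_app2 (fun M r x y => F M (fun n => r (f n)) x y (T3 M r) (T4 M r))
           (fun n => n)); auto.
  apply (localT_app2 (fun M r x y => F M (fun n => r (S (S (f n)))) (r 1) (r 0) x y)
           (fun n => n) (fun M r => T3 M (fun n => r (S (S n))))
           (fun M r => T4 M (fun n => r (S (S n)))));
    [|apply localT_ren; auto|apply localT_ren; auto].
  exact (localT_ren _ (up_ren (up_ren (up_ren (up_ren f)))) HF).
Qed.

(** ** Bounds *)

Lemma bd_in (a : term) (P : forall M : structure, (nat -> M) -> M -> Prop) :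
  localT a -> (forall M : structure, ZFC M -> forall r x, P M r x -> x ∈ a M r) -> bd P.
Proof.
  intros [[c Hc] _] H. exists (S c). intros M HM A r Hr x Hx.
  apply (level_elem HM c A x (a M r)); auto.
Qed.

Lemma bd_eq (a : term) (P : forall M : structure, (nat -> M) -> M -> Prop) :
  localT a -> (forall M : structure, ZFC M -> forall r x, P M r x -> x = a M r) -> bd P.
Proof.
  intros [[c Hc] _] H. exists c. intros M HM A r Hr x Hx. rewrite (H M HM r x); auto.
Qed.

Lemma bd_or (P Q : forall M : structure, (nat -> M) -> M -> Prop) :
  bd P -> bd Q -> bd (fun M r x => P M r x \/ Q M r x).
Proof.
  intros [c Hc] [d Hd]. exists (c + d). intros M HM A r Hr x [Hx|Hx].
  - apply (level_mono HM c); [lia|]. eauto.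
  - apply (level_mono HM d); [lia|]. eauto.
Qed.

Lemma bd_impl (P Q : forall M : structure, (nat -> M) -> M -> Prop) :
  bd Q -> (forall M : structure, ZFC M -> forall r x, P M r x -> Q M r x) -> bd P.
Proof. intros [c Hc] H. exists c. intros M HM A r Hr x Hx. eauto. Qed.

(** A set of elements of a level is an element of the next one. *)
Lemma bd_elements (Q P : forall M : structure, (nat -> M) -> M -> Prop) :
  bd Q -> (forall M : structure, ZFC M -> forall r x, P M r x -> forall z, z ∈ x -> Q M r z) ->
  bd P.
Proof.
  intros [c Hc] H. exists (S c). intros M HM A r Hr x Hx.
  apply (level_part HM). intros z Hz. eauto.
Qed.

Lemma bd_ex (G : forall M : structure, (nat -> M) -> M -> Prop)
  (P : forall M : structure, (nat -> M) -> M -> M -> Prop) :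
  bd G -> bd (fun M r x => P M (fun n => r (S n)) (r 0) x) ->
  (forall M : structure, ZFC M -> forall r y x, P M r y x -> G M r y) ->
  bd (fun M r x => exists y, P M r y x).
Proof.
  intros [c Hc] [d Hd] H. exists (d + c). intros M HM A r Hr x [y Hy].
  rewrite <- level_add. apply (Hd M HM _ (scons y r)); auto.
  apply framed_scons_level; eauto.
Qed.

Lemma bd_ex_in (a : term) (P : forall M : structure, (nat -> M) -> M -> M -> Prop) :
  localT a -> bd (fun M r x => P M (fun n => r (S n)) (r 0) x) ->
  (forall M : structure, ZFC M -> forall r y x, P M r y x -> y ∈ a M r) ->
  bd (fun M r x => exists y, P M r y x).
Proof.
  intros Ha HP H. apply (bd_ex (fun M r y => y ∈ a M r)); auto. apply (bd_in a); auto.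
Qed.

Lemma local_bex (a : term) (P : forall M : structure, (nat -> M) -> M -> Prop) :
  localT a -> local1 P ->
  (forall M : structure, ZFC M -> forall r x, P M r x -> x ∈ a M r) ->
  local (fun M r => exists x, P M r x).
Proof. intros; apply local_ex; auto. eapply bd_in; eauto. Qed.

Lemma local_ball (a : term) (P : forall M : structure, (nat -> M) -> M -> Prop) :
  localT a -> local1 P ->
  (forall M : structure, ZFC M -> forall r x, ~ x ∈ a M r -> P M r x) ->
  local (fun M r => forall x, P M r x).
Proof.
  intros; apply local_all; auto. eapply bd_in; eauto.
  intros M HM r x N. apply NNPP; auto.
Qed.

(** An unbounded universal quantifier is harmless if its strongest instance is
    a bounded term. *)
Lemma local_all_instance (a : term) (P : forall M : structure, (nat -> M) -> M -> Prop) :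
  bounded a -> local1 P ->
  (forall M : structure, ZFC M -> forall r, P M r (a M r) -> forall x, P M r x) ->
  local (fun M r => forall x, P M r x).
Proof.
  intros Ha [p Hp] H. exists (fAll p). intros M HM U A r HU HA Hr; simpl.
  assert (E : forall x, x ∈ U -> (P M r x <-> satU U (scons x r) p)).
  { intros x Hx. destruct (universe_extend HM U A r x) as [B [HB HB']]; auto.
    apply (Hp M HM U B (scons x r)); auto. }
  split.
  - intros HP x Hx. apply E; auto.
  - intros HP. apply H; auto. apply E; [|apply HP]; eapply bounded_in_universe; eauto.
Qed.

(** ** Descriptions and comprehensions *)

(** Because the candidates are bounded, existence and uniqueness mean the same
    inside and outside of the universe. *)
Lemma localT_the (P : forall M : structure, (nat -> M) -> M -> Prop) :
  local1 P -> bd P -> localT (fun M r => the (P M r)).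
Proof.
  intros HP HB. split.
  - destruct HB as [c Hc]. exists (S c). intros M HM A r Hr.
    destruct (the_or_empty HM (P M r)) as [H|H].
    + apply (level_mono HM c); [lia|]. eauto.
    + rewrite H. apply (level_part HM). intros z Hz; elim (in_empty HM z Hz).
  - apply local_iff with (Q := fun M r => unique (P M (fun n => r (S n))) (r 0) \/
      (~ (exists z, unique (P M (fun n => r (S n))) z) /\ forall z, ~ z ∈ r 0)).
    { intros M HM r. apply (the_graph HM). }
    assert (HQ : local (fun M r => unique (P M (fun n => r (S n))) (r 0))).
    { apply local_and; [exact HP|]. apply local_all.
      - apply local_imp; [|apply local_eq; apply localT_var].
        exact (local_ren _ (fun n => match n with 0 => 0 | S k => S (S k) end) HP).
      - destruct HB as [c Hc]. exists c. intros M HM A r Hr x Hx.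
        apply (Hc M HM A (fun n => r (S n))); [apply (framed_ren A r S), Hr|].
        apply NNPP; tauto. }
    apply local_or; [exact HQ|]. apply local_and.
    + apply local_not, local_ex.
      * exact (local_ren _ (fun n => match n with 0 => 0 | S k => S (S k) end) HQ).
      * destruct HB as [c Hc]. exists c. intros M HM A r Hr x [Hx _].
        apply (Hc M HM A (fun n => r (S n))); auto. apply (framed_ren A r S), Hr.
    + apply (local_ball (fun M r => r 0)); [apply localT_var| |auto].
      apply local_not, local_mem; apply localT_var.
Qed.

Lemma localT_cls (P : forall M : structure, (nat -> M) -> M -> Prop) :
  local1 P -> bd P -> localT (fun M r => cls (P M r)).
Proof.
  intros HP HB. apply (localT_the (fun M r y => forall x, x ∈ y <-> P M r x)).
  - apply local_all.
    + assert (H : local (fun M r => P M (fun n => r (S (S n))) (r 0)))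
        by exact (local_ren _ (fun n => match n with 0 => 0 | S k => S (S k) end) HP).
      assert (H' : local (fun M r => r 0 ∈ r 1)) by (apply local_mem; apply localT_var).
      exact (local_and _ _ (local_imp _ _ H' H) (local_imp _ _ H H')).
    + apply bd_impl with (Q := fun M r x => x ∈ r 0 \/ P M (fun n => r (S n)) x).
      * apply bd_or; [apply (bd_in (fun M r => r 0)); auto; apply localT_var|].
        destruct HB as [c Hc]. exists c. intros M HM A r Hr x Hx.
        apply (Hc M HM A (fun n => r (S n))); auto. apply (framed_ren A r S), Hr.
      * intros M HM r x Hx. apply NNPP; tauto.
  - apply (bd_elements P); auto. intros M HM r y Hy z Hz. apply Hy, Hz.
Qed.

(** The formula which separates has a universe among its parameters. *)
Lemma local_separation (P : pred) : local P -> forall M : structure, ZFC M ->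
  forall (A a : M) r, (forall n, r n ∈ A) ->
  exists b, forall x, x ∈ b <-> x ∈ a /\ P M (scons x r).
Proof.
  intros [p Hp] M HM A a r Hr.
  destruct (exists_universe HM empty) as [W [HW _]].
  destruct (exists_universe HM (upair (upair A a) W)) as [U [HU H]].
  assert (HWU : W ∈ U) by (apply H, (in_upair HM); auto).
  assert (HAa : upair A a ∈ U) by (apply H, (in_upair HM); auto).
  assert (HAU : A ∈ U) by (apply (univ_trans U HU (upair A a)); auto; apply (in_upair HM); auto).
  assert (HaU : a ∈ U) by (apply (univ_trans U HU (upair A a)); auto; apply (in_upair HM); auto).
  destruct (univ_grow U HU A W HAU HWU) as [B [HB [HWB HAB]]].
  assert (HF : framed B r).
  { split; eauto. intros n; apply HAB, (subset_grow HM); auto. }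
  destruct (zf_sep M HM (rel (up_ren S) 1 p) (scons U r) a) as [b Hb].
  exists b. intros x. rewrite Hb.
  assert (E : x ∈ a -> (P M (scons x r) <-> sat (scons x (scons U r)) (rel (up_ren S) 1 p))).
  { intros Hx. assert (x ∈ U) by (apply (univ_trans U HU a); auto).
    destruct (universe_extend HM U B r x) as [C [HC HC']]; auto.
    rewrite (sat_rel p (up_ren S) 1 (scons x r)).
    - apply (Hp M HM U C (scons x r)); auto.
    - intros [|i]; reflexivity. }
  tauto.
Qed.

(** * Locality of the definitions *)

(** For bounding the components of pairs. *)
Definition un {M : structure} (a : M) : M := ⦃ x | exists y, y ∈ a /\ x ∈ y ⦄.

Lemma in_un {M : structure} (HM : ZFC M) (a x : M) :
  x ∈ un a <-> exists y, y ∈ a /\ x ∈ y.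
Proof.
  apply (cls_spec HM (fun x => exists y, y ∈ a /\ x ∈ y)). apply (zf_union M HM).
Qed.

Section Components.
Context {M : structure} (HM : ZFC M).
Implicit Types p x y f : M.

Lemma sing_component p x : p = sing x -> x ∈ p.
Proof. intros ->; apply (in_sing HM); auto. Qed.
Lemma fst_component p x y : p = opair x y -> x ∈ un p.
Proof.
  intros ->. apply (in_un HM). exists (upair x y). unfold opair.
  rewrite !(in_upair HM); auto.
Qed.
Lemma snd_component p x y : p = opair x y -> y ∈ un p.
Proof.
  intros ->. apply (in_un HM). exists (upair x y). unfold opair.
  rewrite !(in_upair HM); auto.
Qed.
Lemma dom_component f x y : opair x y ∈ f -> x ∈ un (un f).
Proof.
  intros H.
  apply (in_un HM). exists (upair x y). rewrite (in_upair HM). split; auto.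
  apply (in_un HM). exists (opair x y). split; auto. unfold opair at 1.
  rewrite (in_upair HM); auto.
Qed.
Lemma ran_component f x y : opair x y ∈ f -> y ∈ un (un f).
Proof.
  intros H. apply (in_un HM). exists (upair x y). rewrite (in_upair HM). split; auto.
  apply (in_un HM). exists (opair x y). split; auto. unfold opair at 1.
  rewrite (in_upair HM); auto.
Qed.
Lemma sing_sing_component p x y : p = sing (opair x (sing y)) -> y ∈ un (un (un p)).
Proof.
  intros ->. apply (in_un HM). exists (sing y). split; [|apply (in_sing HM); auto].
  apply ran_component with x. apply (in_sing HM); auto.
Qed.
End Components.

(** ** Automation *)

(** Uses the hypotheses about abstract terms and predicates, up to renaming of
    the variables and substitution for the arguments. *)
Ltac loc_hyp :=
  match goal with
  | H : _ |- _ => exact H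
  | H : localT ?T |- localT _ => apply (localT_ren T _ H)
  | H : local ?T |- local _ => apply (local_ren T _ H)
  | H : localT _ |- localT _ => apply (fun f T => localT_app1 _ f T H)
  | H : localT _ |- localT _ => apply (fun f S T => localT_app2 _ f S T H)
  | H : localT _ |- localT _ => apply (fun f S T S' T' => localT_app4 _ f S T S' T' H)
  | H : local _ |- local _ => apply (fun f T => local_app1 _ f T H)
  | H : local _ |- local _ => apply (fun f S T => local_app2 _ f S T H)
  end.

(** Finds a set that contains the left-hand side, for a goal [x ∈ ?a]. *)
Ltac component :=
  match goal with
  | H : ?x ∈ ?b |- ?x ∈ ?c => unify c b; exact H
  | H : ?p = sing ?x |- ?x ∈ ?c => unify c p; eapply sing_component; eassumption
  | H : ?p = opair ?x _ |- ?x ∈ ?c => unify c (un p); eapply fst_component; eassumption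
  | H : ?p = opair _ ?x |- ?x ∈ ?c => unify c (un p); eapply snd_component; eassumption
  | H : ?p = sing (opair ?x _) |- ?x ∈ ?c => unify c (un (un p));
      eapply dom_component; [eassumption | eapply sing_component; eassumption]
  | H : ?p = sing (opair _ ?x) |- ?x ∈ ?c => unify c (un (un p));
      eapply ran_component; [eassumption | eapply sing_component; eassumption]
  | H : ?p = sing (opair _ (sing ?x)) |- ?x ∈ ?c => unify c (un (un (un p)));
      eapply sing_sing_component; eassumption
  | H : ?p = opair _ (opair ?x _) |- ?x ∈ ?c => unify c (un (un (un p)));
      eapply dom_component; [eassumption | eapply snd_component; eassumption]
  | H : ?p = opair _ (opair _ ?x) |- ?x ∈ ?c => unify c (un (un (un p)));
      eapply ran_component; [eassumption | eapply snd_component; eassumption]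
  | H : opair ?x _ ∈ ?f |- ?x ∈ ?c => unify c (un (un f)); eapply dom_component; eassumption
  | H : opair _ ?x ∈ ?f |- ?x ∈ ?c => unify c (un (un f)); eapply ran_component; eassumption
  end.

Ltac split_hyps := repeat match goal with
  | H : _ /\ _ |- _ => destruct H
  | H : exists _, _ |- _ => destruct H
  | H : unique _ _ |- _ => destruct H
  end.

(** The bound of a quantifier is read off from the hypotheses that restrict the
    quantified variable. *)
Ltac loc_ex := eapply local_bex; [ | | intros ? ? ? ? ?; split_hyps; component ].
Ltac loc_all := eapply local_ball;
  [ | | intros ? ? ? ? ?; unfold unique, subset; intros; exfalso; split_hyps;
    match goal with N : ~ _ |- False => apply N; component end ].

(** The table of the defined symbols already treated, extended as new locality
    lemmas are proved; the head symbol selects the lemma. *)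
Ltac loc_rule := fail.

Ltac bd_in := eapply bd_in; [ | intros ? ? ? ? ?; split_hyps; component ].
Ltac bd_eq := eapply bd_eq; [ | intros ? ? ? ? ?; split_hyps;
    match goal with H : ?x = ?b |- ?x = ?c => unify c b; exact H end ].

(** The same for predicates with a bounded extension. *)
Ltac bd_rule := fail.

Ltac loc_step := cbv beta; lazymatch goal with
  | |- localT (fun M r => r _) => apply localT_var
  | |- localT _ => first [ loc_hyp | loc_rule | apply localT_cls | apply localT_the ]
  | |- local (fun M r => _ = _) => apply local_eq
  | |- local (fun M r => _ ∈ _) => apply local_mem
  | |- local (fun M r => False) => apply local_False
  | |- local (fun M r => _ /\ _) => apply local_and
  | |- local (fun M r => ~ _) => apply local_not
  | |- local (fun M r => _ \/ _) => apply local_or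
  | |- local (fun M r => exists x, _) => loc_ex
  | |- local (fun M r => forall x, _) => first [ apply local_imp | loc_all ]
  | |- local _ => first [ loc_hyp | loc_rule ]
  | |- bd _ => first [ bd_rule | bd_in | bd_eq | apply bd_or
       | eapply bd_ex_in; [ | | intros ? ? ? ? ? ?; split_hyps; component ] ]
  end.
Ltac loc := repeat loc_step.

(** ** From pairs to simplicial sets *)

Lemma localT_empty : localT (fun M r => empty).
Proof.
  unfold empty. apply localT_cls; [apply local_False|].
  exists 0. intros ? ? ? ? ? ? [].
Qed.

Lemma localT_un a : localT a -> localT (fun M r => un (a M r)).
Proof. intros. unfold un. loc.  Qed.
Lemma localT_sing a : localT a -> localT (fun M r => sing (a M r)).
Proof. intros; unfold sing; loc. Qed.
Lemma localT_upair a b : localT a -> localT b -> localT (fun M r => upair (a M r) (b M r)).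
Proof. intros; unfold upair; loc. Qed.
Ltac loc_rule0 := lazymatch goal with
  | |- localT (fun M r => @empty _) => apply localT_empty
  | |- localT (fun M r => un _) => apply localT_un
  | |- localT (fun M r => sing _) => apply localT_sing
  | |- localT (fun M r => upair _ _) => apply localT_upair
  | _ => fail
  end.
Ltac loc_rule ::= loc_rule0.
Lemma localT_opair a b : localT a -> localT b -> localT (fun M r => opair (a M r) (b M r)).
Proof. intros; unfold opair; loc. Qed.
Ltac loc_rule1 := lazymatch goal with
  | |- localT (fun M r => opair _ _) => apply localT_opair
  | _ => loc_rule0
  end.
Ltac loc_rule ::= loc_rule1.
Lemma localT_pi1 a : localT a -> localT (fun M r => pi1 (a M r)).
Proof. intros; unfold pi1; loc. Qed.
Lemma localT_pi2 a : localT a -> localT (fun M r => pi2 (a M r)).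
Proof. intros; unfold pi2; loc. Qed.
Lemma local_subset a b : localT a -> localT b -> local (fun M r => subset (a M r) (b M r)).
Proof. intros; unfold subset; loc. Qed.
Lemma localT_succ a : localT a -> localT (fun M r => succ (a M r)).
Proof. intros; unfold succ; loc. Qed.
Lemma localT_one : localT (fun M r => one).
Proof. unfold one. apply localT_succ, localT_empty. Qed.
Ltac loc_rule2 := lazymatch goal with
  | |- local (fun M r => subset _ _) => apply local_subset
  | |- localT (fun M r => pi1 _) => apply localT_pi1
  | |- localT (fun M r => pi2 _) => apply localT_pi2
  | |- localT (fun M r => @one _) => apply localT_one
  | |- localT (fun M r => succ _) => apply localT_succ
  | _ => loc_rule1
  end.
Ltac loc_rule ::= loc_rule2.

Lemma local_inductive a : localT a -> local (fun M r => inductive (a M r)).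
Proof. intros; unfold inductive; loc. Qed.

(** The definition of [omega] quantifies over all inductive sets, but [omega]
    itself is the strongest instance. *)
Lemma localT_omega : localT (fun M r => omega).
Proof.
  assert (HB : bounded (fun M r => omega)).
  { exists 2. intros M HM A r [[W [HW HW']] _]. apply (level_part HM).
    intros n Hn. apply (level_elem HM 0 A n W); auto. apply (universe_omega HM W HW'), Hn. }
  split; auto.
  apply local_iff with (Q := fun M r => inductive (r 0) /\
    forall w, inductive w -> subset (r 0) w).
  - intros M HM r. split.
    + intros ->. split; [apply (omega_inductive HM)|].
      intros w Hw n Hn. exact (proj1 (in_omega HM n) Hn w Hw).
    + intros [H1 H2]. apply (zf_ext M HM). intros n; split; intros Hn.
      * apply (H2 omega); auto. apply (omega_inductive HM).
      * exact (proj1 (in_omega HM n) Hn _ H1).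
  - apply local_and; [apply local_inductive, localT_var|].
    apply (local_all_instance (fun M r => omega)); auto.
    + apply local_imp; [apply local_inductive, localT_var|].
      apply local_subset; apply localT_var.
    + intros M HM r H w Hw n Hn. apply (fun h => proj1 (in_omega HM n) h w Hw).
      apply (H (omega_inductive HM)), Hn.
Qed.

Lemma localT_app f x : localT f -> localT x -> localT (fun M r => app (f M r) (x M r)).
Proof. intros; unfold app; loc. Qed.

Ltac loc_rule3 := lazymatch goal with
  | |- local (fun M r => inductive _) => apply local_inductive
  | |- localT (fun M r => @omega _) => apply localT_omega
  | |- localT (fun M r => app _ _) => apply localT_app
  | _ => loc_rule2
  end.
Ltac loc_rule ::= loc_rule3.

Lemma local_func f a : localT f -> localT a -> local (fun M r => func (f M r) (a M r)).
Proof. intros; unfold func, unique; loc. Qed.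
Lemma local_is_fun f a b : localT f -> localT a -> localT b ->
  local (fun M r => is_fun (f M r) (a M r) (b M r)).
Proof. intros; unfold is_fun. apply local_and; [apply local_func; auto|]. loc. Qed.
Lemma localT_lam a F : localT a -> localT1 F -> localT (fun M r => lam (a M r) (F M r)).
Proof. intros; unfold lam; loc. Qed.
Lemma localT_comp f g : localT f -> localT g -> localT (fun M r => comp (f M r) (g M r)).
Proof. intros; unfold comp; loc. Qed.

Ltac loc_rule4 := lazymatch goal with
  | |- local (fun M r => is_fun _ _ _) => apply local_is_fun
  | |- local (fun M r => func _ _) => apply local_func
  | |- localT (fun M r => lam _ _) => apply localT_lam
  | |- localT (fun M r => comp _ _) => apply localT_comp
  | _ => loc_rule3
  end.
Ltac loc_rule ::= loc_rule4.
(** The elements of a function are pairs of bounded components, so no product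
    set has to be formed. *)
Lemma bd_is_fun a b : localT a -> localT b ->
  bd (fun M r f => is_fun f (a M r) (b M r)).
Proof.
  intros. apply bd_elements with (Q := fun M r z => exists x y,
    x ∈ a M r /\ y ∈ b M r /\ z = opair x y).
  - loc.
  - intros M HM r f [Hf Hb] z Hz. destruct (func_elem HM f _ z Hf Hz) as [x [Hx E]]. eauto 6.
Qed.

Lemma localT_mono m n : localT m -> localT n -> localT (fun M r => mono (m M r) (n M r)).
Proof.
  intros; unfold mono; loc.
  apply bd_impl with (Q := fun M r f => is_fun f (succ (m M r)) (succ (n M r))); [|tauto].
  apply bd_is_fun; loc.
Qed.
Lemma localT_idm n : localT n -> localT (fun M r => idm (n M r)).
Proof. intros; unfold idm; loc. Qed.
Lemma localT_cst n i : localT n -> localT i -> localT (fun M r => cst (n M r) (i M r)).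
Proof. intros; unfold cst; loc. Qed.
Lemma localT_tri m n f : localT m -> localT n -> localT f ->
  localT (fun M r => tri (m M r) (n M r) (f M r)).
Proof. intros; unfold tri; loc. Qed.
Ltac loc_rule5 := lazymatch goal with
  | |- localT (fun M r => mono _ _) => apply localT_mono
  | |- localT (fun M r => idm _) => apply localT_idm
  | |- localT (fun M r => cst _ _) => apply localT_cst
  | |- localT (fun M r => tri _ _ _) => apply localT_tri
  | _ => loc_rule4
  end.
Ltac loc_rule ::= loc_rule5.
Lemma localT_simplex_mor : localT (fun M r => simplex_mor).
Proof. intros; unfold simplex_mor; loc. Qed.
Lemma localT_simp X n : localT X -> localT n -> localT (fun M r => simp (X M r) (n M r)).
Proof. intros; unfold simp; loc. Qed.
Lemma localT_act X m n f x : localT X -> localT m -> localT n -> localT f -> localT x ->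
  localT (fun M r => act (X M r) (m M r) (n M r) (f M r) (x M r)).
Proof. intros; unfold act; loc. Qed.
Ltac loc_rule6 := lazymatch goal with
  | |- localT (fun M r => @simplex_mor _) => apply localT_simplex_mor
  | |- localT (fun M r => simp _ _) => apply localT_simp
  | |- localT (fun M r => act _ _ _ _ _) => apply localT_act
  | _ => loc_rule5
  end.
Ltac loc_rule ::= loc_rule6.
Lemma local_is_sset X : localT X -> local (fun M r => is_sset (X M r)).
Proof. intros; unfold is_sset; loc. Qed.
Lemma localT_mk_sset C A : localT1 C -> localT4 A ->
  localT (fun M r => mk_sset (C M r) (A M r)).
Proof. intros; unfold mk_sset; loc. Qed.
Lemma localT_ap f n x : localT f -> localT n -> localT x ->
  localT (fun M r => ap (f M r) (n M r) (x M r)).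
Proof. intros; unfold ap; loc. Qed.
Ltac loc_rule7 := lazymatch goal with
  | |- local (fun M r => is_sset _) => apply local_is_sset
  | |- localT (fun M r => mk_sset _ _) => apply localT_mk_sset
  | |- localT (fun M r => ap _ _ _) => apply localT_ap
  | _ => loc_rule6
  end.
Ltac loc_rule ::= loc_rule7.
Lemma local_smap f X Y : localT f -> localT X -> localT Y ->
  local (fun M r => smap (f M r) (X M r) (Y M r)).
Proof. intros; unfold smap; loc. Qed.
Lemma localT_mk_smap X F : localT X ->
  localT2 F ->
  localT (fun M r => mk_smap (X M r) (F M r)).
Proof. intros; unfold mk_smap; loc. Qed.
Lemma localT_simplex n : localT n -> localT (fun M r => simplex (n M r)).
Proof. intros; unfold simplex; loc. Qed.
Lemma localT_sprod X Y : localT X -> localT Y -> localT (fun M r => sprod (X M r) (Y M r)).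
Proof. intros; unfold sprod; loc. Qed.
Lemma local_boundary n q f : localT n -> localT q -> localT f ->
  local (fun M r => boundary (n M r) (q M r) (f M r)).
Proof. intros; unfold boundary; loc. Qed.
Ltac loc_rule8 := lazymatch goal with
  | |- local (fun M r => smap _ _ _) => apply local_smap
  | |- local (fun M r => boundary _ _ _) => apply local_boundary
  | |- localT (fun M r => mk_smap _ _) => apply localT_mk_smap
  | |- localT (fun M r => simplex _) => apply localT_simplex
  | |- localT (fun M r => sprod _ _) => apply localT_sprod
  | _ => loc_rule7
  end.
Ltac loc_rule ::= loc_rule8.

Lemma bd_smap X Y : localT X -> localT Y -> bd (fun M r f => smap f (X M r) (Y M r)).
Proof.
  intros. apply bd_elements with (Q := fun M r z => exists n, n ∈ omega /\ exists g,
    is_fun g (simp (X M r) n) (simp (Y M r) n) /\ z = opair n g).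
  - apply (bd_ex_in (fun M r => omega)); [loc| |tauto].
    apply bd_impl with (Q := fun M r x => exists g,
      is_fun g (simp (X M (fun n => r (S n))) (r 0)) (simp (Y M (fun n => r (S n))) (r 0)) /\
      x = opair (r 0) g); [|tauto].
    apply bd_ex with (G := fun M r g => is_fun g (simp (X M (fun n => r (S n))) (r 0))
      (simp (Y M (fun n => r (S n))) (r 0))); [apply bd_is_fun; loc|loc|tauto].
  - intros M HM r f [Hf [Hb _]] z Hz. destruct (func_elem HM f _ z Hf Hz) as [n [Hn E]]. eauto 6.
Qed.

(** ** Pointed simplicial sets *)

Lemma localT_und P : localT P -> localT (fun M r => und (P M r)).
Proof. intros; unfold und; loc. Qed.
Lemma localT_pt P : localT P -> localT (fun M r => pt (P M r)).
Proof. intros; unfold pt; loc. Qed.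
Ltac loc_rule9 := lazymatch goal with
  | |- localT (fun M r => und _) => apply localT_und
  | |- localT (fun M r => pt _) => apply localT_pt
  | _ => loc_rule8
  end.
Ltac loc_rule ::= loc_rule9.

Lemma localT_psimp P n : localT P -> localT n -> localT (fun M r => psimp (P M r) (n M r)).
Proof. intros; unfold psimp; loc. Qed.
Lemma localT_bp P n : localT P -> localT n -> localT (fun M r => bp (P M r) (n M r)).
Proof. intros; unfold bp; loc. Qed.
Ltac loc_rule10 := lazymatch goal with
  | |- localT (fun M r => psimp _ _) => apply localT_psimp
  | |- localT (fun M r => bp _ _) => apply localT_bp
  | _ => loc_rule9
  end.
Ltac loc_rule ::= loc_rule10.

Lemma local_is_psset P : localT P -> local (fun M r => is_psset (P M r)).
Proof. intros; unfold is_psset; loc. Qed.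
Lemma local_pmap f P Q : localT f -> localT P -> localT Q ->
  local (fun M r => pmap (f M r) (P M r) (Q M r)).
Proof. intros; unfold pmap; loc. Qed.
Lemma bd_pmap P Q : localT P -> localT Q -> bd (fun M r f => pmap f (P M r) (Q M r)).
Proof.
  intros. apply bd_impl with (Q := fun M r f => smap f (und (P M r)) (und (Q M r))).
  - apply bd_smap; loc.
  - intros M HM r f [H1 _]; exact H1.
Qed.
Lemma localT_mk_pmap P F : localT P ->
  localT2 F ->
  localT (fun M r => mk_pmap (P M r) (F M r)).
Proof. intros; unfold mk_pmap; loc. Qed.

Lemma localT_qcls L n x :
  local2 L -> localT n -> localT x ->
  localT (fun M r => qcls (L M r) (n M r) (x M r)).
Proof. intros; unfold qcls; loc. Qed.
Ltac loc_rule11 := lazymatch goal with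
  | |- local (fun M r => is_psset _) => apply local_is_psset
  | |- local (fun M r => pmap _ _ _) => apply local_pmap
  | |- localT (fun M r => mk_pmap _ _) => apply localT_mk_pmap
  | |- localT (fun M r => qcls _ _ _) => apply localT_qcls
  | _ => loc_rule10
  end.
Ltac loc_rule ::= loc_rule11.
Lemma localT_qmap L n F z :
  local2 L -> localT n -> localT1 F ->
  localT z -> localT (fun M r => qmap (L M r) (n M r) (F M r) (z M r)).
Proof. intros; unfold qmap; loc. Qed.
Ltac loc_rule12 := lazymatch goal with
  | |- localT (fun M r => qmap _ _ _ _) => apply localT_qmap
  | _ => loc_rule11
  end.
Ltac loc_rule ::= loc_rule12.
Lemma localT_quo X L : localT X ->
  local2 L ->
  localT (fun M r => quo (X M r) (L M r)).
Proof. intros; unfold quo; loc. Qed.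
Ltac loc_rule13 := lazymatch goal with
  | |- localT (fun M r => quo _ _) => apply localT_quo
  | _ => loc_rule12
  end.
Ltac loc_rule ::= loc_rule13.
Lemma localT_simplex_plus n : localT n -> localT (fun M r => simplex_plus (n M r)).
Proof. intros; unfold simplex_plus, none; loc. Qed.
Lemma localT_sphere1 : localT (fun M r => sphere1).
Proof. intros; unfold sphere1; loc. Qed.
Lemma local_wedge P Q n u : localT P -> localT Q -> localT n -> localT u ->
  local (fun M r => wedge (P M r) (Q M r) (n M r) (u M r)).
Proof. intros; unfold wedge; loc. Qed.
Ltac loc_rule14 := lazymatch goal with
  | |- localT (fun M r => simplex_plus _) => apply localT_simplex_plus
  | |- localT (fun M r => @sphere1 _) => apply localT_sphere1
  | |- local (fun M r => wedge _ _ _ _) => apply local_wedge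
  | _ => loc_rule13
  end.
Ltac loc_rule ::= loc_rule14.
Lemma localT_smash P Q : localT P -> localT Q -> localT (fun M r => smash (P M r) (Q M r)).
Proof. intros; unfold smash; loc. Qed.
Lemma localT_smash_elt P Q n x y :
  localT P -> localT Q -> localT n -> localT x -> localT y ->
  localT (fun M r => smash_elt (P M r) (Q M r) (n M r) (x M r) (y M r)).
Proof. intros; unfold smash_elt; loc. Qed.
Lemma localT_smash_fun P Q n F G z :
  localT P -> localT Q -> localT n -> localT1 F -> localT1 G -> localT z ->
  localT (fun M r => smash_fun (P M r) (Q M r) (n M r) (F M r) (G M r) (z M r)).
Proof. intros; unfold smash_fun; loc. Qed.
Ltac loc_rule15 := lazymatch goal with
  | |- localT (fun M r => smash _ _) => apply localT_smash
  | |- localT (fun M r => smash_elt _ _ _ _ _) => apply localT_smash_elt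
  | |- localT (fun M r => smash_fun _ _ _ _ _ _) => apply localT_smash_fun
  | _ => loc_rule14
  end.
Ltac loc_rule ::= loc_rule15.
Lemma localT_susp P : localT P -> localT (fun M r => susp (P M r)).
Proof. intros; unfold susp; loc. Qed.
Ltac bd_rule ::= lazymatch goal with |- bd (fun M r f => pmap f _ _) => apply bd_pmap end.
Lemma localT_map_pt P Q : localT P -> localT Q -> localT (fun M r => map_pt (P M r) (Q M r)).
Proof. intros; unfold map_pt, none; loc. Qed.
Lemma local_homotopic P Q f g : localT P -> localT Q -> localT f -> localT g ->
  local (fun M r => homotopic (P M r) (Q M r) (f M r) (g M r)).
Proof.
  intros; unfold homotopic. apply local_ex; [loc|].
  apply bd_impl with (Q := fun M r h => pmap h (smash (P M r) (simplex_plus one)) (Q M r));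
    [loc|tauto].
Qed.
Ltac loc_rule16 := lazymatch goal with
  | |- localT (fun M r => susp _) => apply localT_susp
  | |- localT (fun M r => map_pt _ _) => apply localT_map_pt
  | |- local (fun M r => homotopic _ _ _ _) => apply local_homotopic
  | _ => loc_rule15
  end.
Ltac loc_rule ::= loc_rule16.
Lemma localT_space E n : localT E -> localT n -> localT (fun M r => space (E M r) (n M r)).
Proof. intros; unfold space; loc. Qed.
Lemma localT_smap_of E n : localT E -> localT n -> localT (fun M r => smap_of (E M r) (n M r)).
Proof. intros; unfold smap_of; loc. Qed.
Ltac loc_rule17 := lazymatch goal with
  | |- localT (fun M r => space _ _) => apply localT_space
  | |- localT (fun M r => smap_of _ _) => apply localT_smap_of
  | _ => loc_rule16
  end.
Ltac loc_rule ::= loc_rule17.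
Lemma localT_assembly A X Y q z : localT A -> localT X -> localT Y -> localT q -> localT z ->
  localT (fun M r => assembly (A M r) (X M r) (Y M r) (q M r) (z M r)).
Proof. intros; unfold assembly; loc. Qed.
Ltac loc_rule18 := lazymatch goal with
  | |- localT (fun M r => assembly _ _ _ _ _) => apply localT_assembly
  | _ => loc_rule17
  end.
Ltac loc_rule ::= loc_rule18.

(** * Iteration *)

Section LevelBounds.
Context {M : structure} (HM : ZFC M).
Implicit Types a f x y z A : M.

Lemma level_sing c A x : x ∈ level c A -> sing x ∈ level (S c) A.
Proof. intros Hx. apply (level_part HM). intros z Hz. apply (in_sing HM) in Hz as ->; auto. Qed.

Lemma level_upair c A x y : x ∈ level c A -> y ∈ level c A -> upair x y ∈ level (S c) A.
Proof.
  intros Hx Hy. apply (level_part HM). intros z Hz. apply (in_upair HM) in Hz as [->| ->]; auto.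
Qed.

Lemma level_opair c A x y : x ∈ level c A -> y ∈ level c A -> opair x y ∈ level (2 + c) A.
Proof. intros Hx Hy. apply level_upair; [apply level_sing|apply level_upair]; auto. Qed.

Lemma level_lam c A a (F : M -> M) : a ∈ level c A ->
  (forall x, x ∈ a -> F x ∈ level (S c) A) -> lam a F ∈ level (4 + c) A.
Proof.
  intros Ha HF. apply (level_part HM). intros p Hp.
  apply in_lam in Hp as [x [Hx ->]]; auto. apply level_opair; auto.
  apply (level_elem HM c A x a); auto.
Qed.

Lemma level_app c A f x : f ∈ level c A -> app f x ∈ level (3 + c) A.
Proof.
  intros Hf. destruct (app_in HM f x) as [H|H].
  - apply (level_elem HM (2 + c) A _ (upair x (app f x))).
    + apply (level_elem HM (1 + c) A _ (opair x (app f x))).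
      * apply (level_elem HM c A _ f); auto.
      * apply (in_upair HM); auto.
    + apply (in_upair HM); auto.
  - rewrite H. apply (level_part HM). intros z Hz; elim (in_empty HM z Hz).
Qed.

Lemma level_omega A (r : nat -> M) : framed A r -> subset omega (level 1 A).
Proof.
  intros [[W [HW HW']] _] n Hn. apply (level_elem HM 0 A n W); auto.
  apply (universe_omega HM W HW'), Hn.
Qed.

End LevelBounds.

(** The set [I] may depend on the assignment; only its level is uniform. *)
Definition invariant (G : pred) (a : term)
  (F : forall M : structure, (nat -> M) -> M -> M) : Prop :=
  exists c, forall M : structure, ZFC M -> forall (A : M) r, framed A r -> G M r ->
  exists I, I ∈ level c A /\ a M r ∈ I /\ forall x, x ∈ I -> F M r x ∈ I.

Definition orbit {M : structure} (a : M) (F : M -> M) (t : M) : Prop :=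
  func t omega /\ app t empty = a /\ forall i, i ∈ omega -> app t (succ i) = F (app t i).

(** Induction along the natural numbers of the structure, which need not be
    standard; it is available because the predicate is local. *)
Lemma orbit_in {M : structure} (HM : ZFC M) (a : M) F t I :
  orbit a F t -> a ∈ I -> (forall x, x ∈ I -> F x ∈ I) ->
  forall i, i ∈ omega -> app t i ∈ I.
Proof.
  intros [_ [H0 HS]] Ha HF.
  assert (HL : local (fun M r => app (r 1) (r 0) ∈ r 2)) by loc.
  destruct (local_separation _ HL M HM (upair t I) omega (scons t (fun _ => I))) as [b Hb].
  { intros [|n]; apply (in_upair HM); auto. }
  cbn -[omega] in Hb. intros i Hi. enough (h : i ∈ b) by (apply Hb in h; tauto).
  revert i Hi. apply (omega_ind HM).
  - apply Hb. split; [apply (omega_inductive HM)|]. rewrite H0; auto.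
  - intros n Hn Hn'. apply Hb in Hn' as [_ Hn']. apply Hb.
    split; [apply (omega_inductive HM), Hn|]. rewrite HS; auto.
  - intros x Hx. apply Hb in Hx; tauto.
Qed.

(** The guard [G] makes the iteration trivial outside of the domain where the
    invariant is available. *)
Definition guarded_iter {M : structure} (G : Prop) (a : M) (F : M -> M) (n : M) : M :=
  the (fun v => exists t, (G /\ orbit a F t) /\ v = app t n).

Lemma guarded_iter_eq {M : structure} (HM : ZFC M) (G : Prop) (a : M) F n :
  G -> guarded_iter G a F n = iter a F n.
Proof.
  intros HG. apply (the_ext HM). intros v. unfold orbit.
  split; intros [t Ht]; exists t; tauto.
Qed.

Lemma localT_guarded_iter G a F n : invariant G a F ->
  local G -> localT a -> localT1 F -> localT n ->
  localT (fun M r => guarded_iter (G M r) (a M r) (F M r) (n M r)).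
Proof.
  intros [c HI] HG Ha HF Hn.
  assert (HO : local (fun M r => orbit (a M (fun n => r (S n))) (F M (fun n => r (S n))) (r 0)))
    by (unfold orbit; loc).
  assert (HB : bd (fun M r t => G M r /\ orbit (a M r) (F M r) t)).
  { exists (5 + c). intros M HM A r Hr t [Hg Ht].
    destruct (HI M HM A r Hr Hg) as [I [HIc [HaI HFI]]].
    apply (level_part HM). intros p Hp.
    destruct (func_elem HM t omega p (proj1 Ht) Hp) as [i [Hi ->]].
    apply (level_mono HM (3 + c)); [lia|]. apply (level_opair HM).
    - apply (level_mono HM 1); [lia|]. apply (level_omega HM A r Hr), Hi.
    - apply (level_elem HM c A _ I); auto. apply (orbit_in HM (a M r) (F M r)); auto. }
  assert (HGO : local (fun M r => G M (fun n => r (S (S n))) /\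
    orbit (a M (fun n => r (S (S n)))) (F M (fun n => r (S (S n)))) (r 0))).
  { apply local_and; [loc|].
    exact (local_ren _ (fun n => match n with 0 => 0 | S k => S (S k) end) HO). }
  unfold guarded_iter. apply localT_the.
  - apply local_ex; [apply local_and; [exact HGO|loc]|].
    apply bd_impl with (Q := fun M r t => G M (fun n => r (S n)) /\
      orbit (a M (fun n => r (S n))) (F M (fun n => r (S n))) t); [|tauto].
    destruct HB as [d Hd]. exists d. intros M HM A r Hr.
    exact (Hd M HM A _ (framed_ren A r S Hr)).
  - apply bd_ex with (G := fun M r t => G M r /\ orbit (a M r) (F M r) t); auto; [loc|tauto].
Qed.

(** * Spheres *)

(** A family of subsets of [W], or of relations contained in [W].  Both
    components of a simplicial set with all simplices in [W] have this form. *)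
Definition thin {M : structure} (W C : M) : Prop :=
  forall p, p ∈ C -> exists n v, n ∈ W /\ subset v W /\ p = opair n v.
Definition small_sset {M : structure} (W X : M) : Prop :=
  exists C D, X = opair C D /\ thin W C /\ thin W D.
(** Quotients are pointed by [empty], and so are all the spheres. *)
Definition small_psset {M : structure} (W P : M) : Prop :=
  exists X, P = opair X empty /\ small_sset W X.

Section Small.
Context {M : structure} (HM : ZFC M) (W : M) (HW : universe W).
Implicit Types a b C D f h k l m n p q t u v x y z X Y P A : M.

Lemma universe_empty : empty ∈ W.
Proof.
  destruct (univ_inhabited W HW) as [x Hx]. apply (univ_subset W HW x); auto.
  intros y Hy; elim (in_empty HM y Hy).
Qed.

Lemma universe_upair x y : x ∈ W -> y ∈ W -> upair x y ∈ W.
Proof.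
  intros Hx Hy. destruct (univ_grow W HW x y Hx Hy) as [z [Hz [Hyz H]]].
  destruct (univ_grow W HW z x Hz Hx) as [z' [Hz' [Hxz H']]].
  apply (univ_subset W HW z'); auto. intros w Hw.
  apply (in_upair HM) in Hw as [->| ->]; auto. apply H', (subset_grow HM), Hyz.
Qed.

Lemma universe_sing x : x ∈ W -> sing x ∈ W.
Proof.
  intros Hx. apply (univ_subset W HW (upair x x)); [apply universe_upair; auto|].
  intros y Hy. apply (in_sing HM) in Hy as ->. apply (in_upair HM); auto.
Qed.

Lemma universe_opair x y : x ∈ W -> y ∈ W -> opair x y ∈ W.
Proof. intros; apply universe_upair; auto using universe_sing, universe_upair. Qed.

Lemma universe_pair_components x y : opair x y ∈ W -> x ∈ W /\ y ∈ W.
Proof.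
  intros H. assert (H' : upair x y ∈ W).
  { apply (univ_trans W HW (opair x y)); auto. apply (in_upair HM); auto. }
  split; apply (univ_trans W HW (upair x y)); auto; apply (in_upair HM); auto.
Qed.

(** A relation between members of two members of [W] is in [W]: no recursion
    on the size of a finite function is needed. *)
Lemma universe_relation a b f : a ∈ W -> b ∈ W ->
  (forall p, p ∈ f -> exists x y, x ∈ a /\ y ∈ b /\ p = opair x y) -> f ∈ W.
Proof.
  intros Ha Hb Hf. pose proof (universe_upair a b Ha Hb) as Hab.
  apply (univ_subset W HW (level 3 (upair a b))); [apply universe_level; auto|].
  intros p Hp. destruct (Hf p Hp) as [x [y [Hx [Hy ->]]]].
  apply (level_opair HM 1); [apply (level_elem HM 0 _ _ a)|apply (level_elem HM 0 _ _ b)];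
    auto; apply (in_upair HM); auto.
Qed.

Lemma universe_mono m n : m ∈ omega -> n ∈ omega -> subset (mono m n) W.
Proof.
  intros Hm Hn f Hf. apply (in_cls HM) in Hf as [[Hf Hf'] _].
  apply (universe_relation (succ m) (succ n));
    try (apply (universe_omega HM W HW), (omega_inductive HM); auto).
  intros p Hp. destruct (func_elem HM f _ p Hf Hp) as [x [Hx ->]]. eauto 6.
Qed.

Lemma universe_comp f h : f ∈ W -> h ∈ W -> comp f h ∈ W.
Proof.
  intros Hf Hh. apply (universe_relation (level 2 h) (level 2 f));
    try (apply universe_level; auto).
  intros p Hp. apply (in_cls HM) in Hp as [x [y [z [H1 [H2 ->]]]]]. exists x, z.
  split; [|split]; auto.
  - apply (level_elem HM 1 _ _ (upair x y)); [|apply (in_upair HM); auto].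
    apply (level_elem HM 0 _ _ (opair x y)); auto. apply (in_upair HM); auto.
  - apply (level_elem HM 1 _ _ (upair y z)); [|apply (in_upair HM); auto].
    apply (level_elem HM 0 _ _ (opair y z)); auto. apply (in_upair HM); auto.
Qed.

Lemma thin_app C n : thin W C -> subset (app C n) W.
Proof.
  intros HC x Hx. destruct (app_in HM C n) as [H|H].
  - destruct (HC _ H) as [n' [v [_ [Hv E]]]]. apply (opair_inj HM) in E as [_ E].
    apply Hv. rewrite <- E; auto.
  - rewrite H in Hx. elim (in_empty HM x Hx).
Qed.

Lemma small_simp X n : small_sset W X -> subset (simp X n) W.
Proof.
  intros [C [D [-> [HC HD]]]]. unfold simp. rewrite (pi1_opair HM). apply thin_app, HC.
Qed.

Lemma small_act X m n h x : small_sset W X -> act X m n h x ∈ W.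
Proof.
  intros [C [D [-> [HC HD]]]]. unfold act. rewrite (pi2_opair HM).
  destruct (app_in HM (app D (tri m n h)) x) as [H| ->]; [|apply universe_empty].
  apply thin_app in H; auto. apply universe_pair_components in H; tauto.
Qed.

Lemma small_mk_sset (C : M -> M) (A : M -> M -> M -> M -> M) :
  (forall n, n ∈ omega -> subset (C n) W) ->
  (forall m n h x, m ∈ omega -> n ∈ omega -> h ∈ mono m n -> x ∈ C n -> A m n h x ∈ W) ->
  small_sset W (mk_sset C A).
Proof.
  intros HC HA. eexists _, _. split; [reflexivity|]. split; intros p Hp.
  - apply (in_lam HM) in Hp as [n [Hn ->]]. exists n, (C n).
    split; auto. apply (universe_omega HM W HW), Hn.
  - apply (in_lam HM) in Hp as [t [Ht ->]].
    apply (in_cls HM) in Ht as [m [n [h [Hm [Hn [Hh ->]]]]]].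
    eexists _, _. split; [|split; [|reflexivity]].
    + apply universe_opair; [apply (universe_omega HM W HW), Hm|].
      apply universe_opair; [apply (universe_omega HM W HW), Hn|].
      apply (universe_mono m n); auto.
    + unfold tri. rewrite ?(pi2_opair HM), ?(pi1_opair HM). intros p Hp.
      apply (in_lam HM) in Hp as [x [Hx ->]]. apply universe_opair; auto.
      apply (HC n); auto.
Qed.

Lemma small_simplex n : n ∈ omega -> small_sset W (simplex n).
Proof.
  intros Hn. apply small_mk_sset.
  - intros q Hq. apply universe_mono; auto.
  - intros k q h x Hk Hq Hh Hx. apply universe_comp.
    + apply (universe_mono q n); auto.
    + apply (universe_mono k q); auto.
Qed.

Lemma small_sprod X Y : small_sset W X -> small_sset W Y -> small_sset W (sprod X Y).
Proof.
  intros HX HY. apply small_mk_sset.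
  - intros n Hn u Hu. apply (in_cls HM) in Hu as [x [y [Hx [Hy ->]]]].
    apply universe_opair; [apply (small_simp X n)|apply (small_simp Y n)]; auto.
  - intros m n h u _ _ _ _. apply universe_opair; apply small_act; auto.
Qed.

Lemma universe_qcls L n x : x ∈ W -> qcls L n x ∈ W.
Proof.
  intros Hx. unfold qcls.
  destruct (the_or_empty HM (fun w => (L n x /\ w = empty) \/ (~ L n x /\ w = sing x)))
    as [[[_ H]|[_ H]]|H]; rewrite H; auto using universe_empty, universe_sing.
Qed.

Lemma small_quo X L : small_sset W X -> small_psset W (quo X L).
Proof.
  intros HX. eexists; split; [reflexivity|]. apply small_mk_sset.
  - intros n Hn z Hz. apply (in_cls HM) in Hz as [->|[x [Hx [_ ->]]]].
    + apply universe_empty.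
    + apply universe_sing, (small_simp X n); auto.
  - intros m n h z _ _ _ _. unfold qmap.
    destruct (the_or_empty HM (fun w => (z = empty /\ w = empty) \/
      exists x, z = sing x /\ w = qcls L m (act X m n h x))) as [[[_ H]|[x [_ H]]]|H];
      rewrite H; auto using universe_empty, universe_qcls, small_act.
Qed.

Lemma small_susp P : small_psset W P -> small_psset W (susp P).
Proof.
  intros [X [-> HX]]. apply small_quo, small_sprod.
  - destruct (small_quo (simplex one) (boundary one)) as [S [E HS]].
    + apply small_simplex, (omega_inductive HM), (omega_inductive HM).
    + unfold sphere1. rewrite E. unfold und. rewrite (pi1_opair HM). exact HS.
  - unfold und. rewrite (pi1_opair HM). exact HX.
Qed.

(** As the simplices are just members of [W], the level is the same for all [P];
    this is why iterated suspension does not climb through the levels. *)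
Lemma small_level A P : W ∈ A -> small_psset W P -> P ∈ level 9 A.
Proof.
  intros HA [X [-> [C [D [-> [HC HD]]]]]].
  assert (H1 : forall x, x ∈ W -> x ∈ level 1 A) by (intros x; apply (level_elem HM 0); auto).
  assert (HT : forall T, thin W T -> T ∈ level 5 A).
  { intros T HT. apply (level_part HM). intros p Hp.
    destruct (HT p Hp) as [n [v [Hn [Hv ->]]]]. apply (level_opair HM 2).
    - apply (level_mono HM 1); auto.
    - apply (level_part HM). intros z Hz; auto. }
  apply (level_opair HM 7).
  - apply (level_opair HM 5); auto.
  - apply (level_mono HM 1); [lia|]. apply H1, universe_empty.
Qed.

End Small.

Lemma invariant_sphere : invariant (fun _ _ => True)
  (fun M r => simplex_plus empty) (fun M r => susp).
Proof.
  exists 10. intros M HM A r [[W [HWA HW]] _] _.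
  assert (HL : local (fun M r => small_psset (r 1) (r 0))).
  { unfold small_psset, small_sset, thin. loc. }
  destruct (local_separation _ HL M HM (sing W) (level 9 A) (fun _ => W)) as [I HI].
  { intros n. apply (in_sing HM); auto. }
  cbn -[level] in HI. exists I. split; [|split].
  - apply (level_part HM). intros P HP. apply HI in HP; tauto.
  - assert (H : small_psset W (simplex_plus empty)).
    { apply (small_quo HM W HW), (small_simplex HM W HW), (omega_inductive HM). }
    apply HI. split; auto. apply (small_level HM W HW); auto.
  - intros P HP. apply HI in HP as [_ HP]. pose proof (small_susp HM W HW P HP) as HP'.
    apply HI. split; auto. apply (small_level HM W HW); auto.
Qed.

Lemma localT_sphere n : localT n -> localT (fun M r => sphere (n M r)).
Proof.
  intros Hn. apply localT_ext with
    (T := fun M r => guarded_iter True (simplex_plus empty) susp (n M r)).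
  - intros M HM r. symmetry. apply (guarded_iter_eq HM). exact I.
  - apply (localT_guarded_iter (fun _ _ => True) (fun M r => simplex_plus empty)
      (fun M r => susp)); auto.
    + exact invariant_sphere.
    + apply local_iff with (Q := fun M r => ~ False); [tauto|loc].
    + loc.
    + loc.
Qed.

(** * Cohomology *)

(** Addition of arbitrary sets would iterate [succ] beyond every level; in the
    definition of cohomology the first summand is a natural number. *)
Definition guarded_add {M : structure} (m a : M) : M := guarded_iter (m ∈ omega) m succ a.

Lemma localT_guarded_add m a : localT m -> localT a ->
  localT (fun M r => guarded_add (m M r) (a M r)).
Proof.
  intros Hm Ha. unfold guarded_add.
  apply (localT_guarded_iter (fun M r => m M r ∈ omega) m (fun M r => succ)); auto; [|loc|loc].
  exists 2. intros M HM A r Hr H. exists omega. split; [|split]; auto.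
  - apply (level_part HM), (level_omega HM A r Hr).
  - apply (omega_inductive HM).
Qed.

Ltac loc_rule19 := lazymatch goal with
  | |- localT (fun M r => guarded_add _ _) => apply localT_guarded_add
  | |- localT (fun M r => sphere _) => apply localT_sphere
  | _ => loc_rule18
  end.
Ltac loc_rule ::= loc_rule19.

Lemma localT_stab E X n m g : localT E -> localT X -> localT n -> localT m -> localT g ->
  localT (fun M r => stab (E M r) (X M r) (n M r) (m M r) (g M r)).
Proof. intros; unfold stab; loc. Qed.

Lemma local_coh_rep E X a b t : localT E -> localT X -> localT a -> localT b -> localT t ->
  local (fun M r => coh_rep (E M r) (X M r) (a M r) (b M r) (t M r)).
Proof.
  intros. apply local_iff with (Q := fun M r => exists n m, n ∈ omega /\ m ∈ omega /\
    exists g, guarded_add m (a M r) = guarded_add n (b M r) /\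
    pmap g (sphere m) (map_pt (X M r) (space (E M r) n)) /\ t M r = opair n (opair m g)).
  - intros M HM r. unfold coh_rep. split.
    + intros [n [m [g [Hn [Hm [E1 H']]]]]]. exists n, m. do 2 (split; auto).
      exists g. unfold guarded_add. rewrite !(guarded_iter_eq HM); auto.
    + intros [n [m [Hn [Hm [g [E1 H']]]]]]. exists n, m, g. do 2 (split; auto).
      unfold guarded_add in E1. rewrite !(guarded_iter_eq HM) in E1; auto.
  - loc.
Qed.

Lemma bd_coh_rep E X a b : localT E -> localT X ->
  bd (fun M r t => coh_rep (E M r) (X M r) (a M r) (b M r) t).
Proof.
  intros. apply bd_impl with (Q := fun M r t => exists n m, n ∈ omega /\ m ∈ omega /\
    exists g, pmap g (sphere m) (map_pt (X M r) (space (E M r) n)) /\ t = opair n (opair m g)).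
  - do 2 (eapply bd_ex_in; [ | | intros ? ? ? ? ? ?; split_hyps; component ]; [loc|]).
    cbv beta. apply bd_impl with (Q := fun M r x => exists g,
      pmap g (sphere (r 0))
        (map_pt (X M (fun n => r (S (S n)))) (space (E M (fun n => r (S (S n)))) (r 1))) /\
      x = opair (r 1) (opair (r 0) g)); [|tauto].
    apply bd_ex with (G := fun M r g => pmap g (sphere (r 0))
      (map_pt (X M (fun n => r (S (S n)))) (space (E M (fun n => r (S (S n)))) (r 1))));
      [apply bd_pmap; loc|loc|tauto].
  - intros M HM r t [n [m [g [Hn [Hm [_ H']]]]]].
    exists n, m. do 2 (split; auto). exists g. exact H'.
Qed.

Ltac loc_rule20 := lazymatch goal with
  | |- localT (fun M r => stab _ _ _ _ _) => apply localT_stab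
  | |- local (fun M r => coh_rep _ _ _ _ _) => apply local_coh_rep
  | _ => loc_rule19
  end.
Ltac loc_rule ::= loc_rule20.

Lemma localT_coh_step E X t : localT E -> localT X -> localT t ->
  localT (fun M r => coh_step (E M r) (X M r) (t M r)).
Proof. intros; unfold coh_step; loc. Qed.

Lemma localT_bound T : localT T -> exists c, forall M : structure, ZFC M ->
  forall (A : M) r, framed A r -> T M r ∈ level c A.
Proof. intros [H _]; exact H. Qed.

(** The bound is uniform in [g]: whatever simplex of the suspension of
    [space E n] is computed from [g], the value of [smap_of E n] at it is a
    component of a pair inside [E], or the default value [empty].  The numerals
    count the steps of [grow] for the four nested graphs, [level_lam], and the
    three nested applications, [level_app]. *)
Lemma stab_level : exists c, forall M : structure, ZFC M -> forall (A : M) r, framed A r ->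
  forall E X n m g, E ∈ A -> X ∈ A -> n ∈ omega -> m ∈ omega -> stab E X n m g ∈ level c A.
Proof.
  destruct (localT_bound (fun M r => simp (und (susp (sphere (r 0)))) (r 1)))
    as [c1 H1]; [loc|].
  destruct (localT_bound (fun M r => simp (und (smash (r 2) (simplex_plus (r 0)))) (r 1)))
    as [c2 H2]; [loc|].
  destruct (localT_bound (fun M r => pi2 (r 0))) as [c3 H3]; [loc|].
  exists (12 + (4 + (9 + c1 + c2 + c3))). intros M HM A r [HW Hr] E X n m g HE HX Hn Hm.
  assert (HA : subset A (level 1 A)) by apply (subset_grow HM).
  assert (HW' : exists W, W ∈ level 1 A /\ universe W)
    by (destruct HW as [W [H H']]; exists W; auto).
  assert (Ho := level_omega HM A r (conj HW Hr)).
  assert (Hom : forall d, omega ∈ level (2 + d) A).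
  { intros d. apply (level_mono HM 2); [lia|]. apply (level_part HM), Ho. }
  apply (level_lam HM (8 + (4 + (9 + c1 + c2 + c3)))); [apply Hom|]. intros q Hq.
  apply (level_mono HM (8 + (4 + (9 + c1 + c2 + c3)))); [lia|].
  apply (level_lam HM (4 + (4 + (9 + c1 + c2 + c3)))).
  { apply (level_mono HM (c1 + 1)); [lia|]. rewrite <- level_add.
    apply (H1 M HM (level 1 A) (scons m (fun _ => q))). split; auto.
    intros [|i]; simpl; apply Ho; auto. }
  intros z Hz. apply (level_mono HM (4 + (4 + (9 + c1 + c2 + c3)))); [lia|].
  apply (level_lam HM (4 + (9 + c1 + c2 + c3))); [apply Hom|]. intros k Hk.
  apply (level_mono HM (4 + (9 + c1 + c2 + c3))); [lia|].
  apply (level_lam HM (9 + c1 + c2 + c3)).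
  { apply (level_mono HM (c2 + 1)); [lia|]. rewrite <- level_add.
    apply (H2 M HM (level 1 A) (scons q (scons k (fun _ => X)))). split; auto.
    intros [|[|i]]; simpl; auto. }
  intros w Hw. apply (level_mono HM (3 + (3 + (3 + c3)))); [lia|].
  do 3 apply (level_app HM). apply (H3 M HM A (fun _ => E)). split; auto.
Qed.

Lemma level_snd {M : structure} (HM : ZFC M) c (A : M) x y :
  opair x y ∈ level c A -> y ∈ level (2 + c) A.
Proof.
  intros H. apply (level_elem HM (1 + c) _ _ (upair x y)); [|apply (in_upair HM); auto].
  apply (level_elem HM c _ _ (opair x y)); auto. apply (in_upair HM); auto.
Qed.

(** Triples of two natural numbers and a set of fixed level: the step changes
    the numbers to their successors, and its third component is bounded by
    [stab_level]. *)
Lemma invariant_coh_step E X a b t :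
  localT E -> localT X -> localT t ->
  invariant (fun M r => coh_rep (E M r) (X M r) (a M r) (b M r) (t M r)) t
    (fun M r => coh_step (E M r) (X M r)).
Proof.
  intros HE HX Ht. destruct stab_level as [c1 H1].
  destruct (localT_bound t Ht) as [c2 H2].
  destruct (localT_bound E HE) as [c3 H3], (localT_bound X HX) as [c4 H4].
  pose (d := c1 + c2 + c3 + c4 + 8).
  exists (5 + d). intros M HM A r Hr [n [m [g [Hn [Hm [_ [_ Eg]]]]]]].
  assert (HL : local (fun M r => exists n m g, n ∈ omega /\ m ∈ omega /\ g ∈ r 1 /\
    r 0 = opair n (opair m g))) by loc.
  destruct (local_separation _ HL M HM (sing (level d A)) (level (4 + d) A)
    (fun _ => level d A)) as [I HI].
  { intros i. apply (in_sing HM); auto. }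
  cbn -[level d omega] in HI. clear HL.
  assert (Ho := level_omega HM A r Hr).
  assert (Hin : forall n m g, n ∈ omega -> m ∈ omega -> g ∈ level d A ->
    opair n (opair m g) ∈ I).
  { clear - HM HI Ho. intros n m g Hn Hm Hg. apply HI. split; [|exists n, m, g; auto].
    apply (level_opair HM (2 + d)).
    - apply (level_mono HM 1); [lia|]. auto.
    - apply (level_opair HM d); auto. apply (level_mono HM 1); [unfold d; lia|]. auto. }
  exists I. split; [|split].
  - apply (level_part HM). intros z Hz. apply HI in Hz; tauto.
  - rewrite Eg. apply Hin; auto. apply (level_mono HM (2 + (2 + c2))); [unfold d; lia|].
    apply (level_snd HM _ _ m), (level_snd HM _ _ n). rewrite <- Eg. auto.
  - clear n m g Hn Hm Eg. intros z Hz. apply HI in Hz as [_ [n [m [g [Hn [Hm [Hg ->]]]]]]].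
    unfold coh_step. rewrite ?(pi2_opair HM), ?(pi1_opair HM).
    apply Hin; try apply (omega_inductive HM); auto.
    apply (level_mono HM (c1 + (c3 + c4))); [unfold d; lia|]. rewrite <- level_add.
    assert (HA : subset A (level (c3 + c4) A)) by (apply (level_mono HM 0); lia).
    apply (H1 M HM _ r); auto.
    + destruct Hr as [[W [HW HW']] Hr]. split; eauto.
    + apply (level_mono HM c3); [lia|]. auto.
    + apply (level_mono HM c4); [lia|]. auto.
Qed.

(** The guard is what the definition of cohomology provides, since it compares
    representatives only; for any other [t] the level of the iterates is not
    under control. *)
Definition guarded_coh_iter {M : structure} (E X a b t i : M) : M :=
  guarded_iter (coh_rep E X a b t) t (coh_step E X) i.

Lemma localT_guarded_coh_iter E X a b t i :
  localT E -> localT X -> localT a -> localT b -> localT t -> localT i ->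
  localT (fun M r => guarded_coh_iter (E M r) (X M r) (a M r) (b M r) (t M r) (i M r)).
Proof.
  intros. unfold guarded_coh_iter.
  apply (localT_guarded_iter (fun M r => coh_rep (E M r) (X M r) (a M r) (b M r) (t M r)) t
    (fun M r => coh_step (E M r) (X M r))); auto.
  - apply invariant_coh_step; auto.
  - loc.
  - apply localT_coh_step; loc.
Qed.

Ltac loc_rule21 := lazymatch goal with
  | |- localT (fun M r => guarded_coh_iter _ _ _ _ _ _) => apply localT_guarded_coh_iter
  | _ => loc_rule20
  end.
Ltac loc_rule ::= loc_rule21.

Definition guarded_coh_eq {M : structure} (E X a b t t' : M) : Prop :=
  exists i j n m g g', i ∈ omega /\ j ∈ omega /\
    guarded_coh_iter E X a b t i = opair n (opair m g) /\
    guarded_coh_iter E X a b t' j = opair n (opair m g') /\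
    homotopic (sphere m) (map_pt X (space E n)) g g'.

Lemma local_guarded_coh_eq E X a b t t' :
  localT E -> localT X -> localT a -> localT b -> localT t -> localT t' ->
  local (fun M r =>
    guarded_coh_eq (E M r) (X M r) (a M r) (b M r) (t M r) (t' M r)).
Proof. intros. unfold guarded_coh_eq. loc. Qed.

Lemma guarded_coh_eq_iff {M : structure} (HM : ZFC M) (E X a b t t' : M) :
  coh_rep E X a b t -> coh_rep E X a b t' ->
  (guarded_coh_eq E X a b t t' <-> coh_eq E X t t').
Proof.
  intros Ht Ht'. unfold guarded_coh_eq, guarded_coh_iter.
  split; intros [i [j H]]; exists i, j;
    rewrite !(guarded_iter_eq HM) in *; auto.
Qed.

Lemma localT_cohomology E X a b :
  localT E -> localT X -> localT a -> localT b ->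
  localT (fun M r => cohomology (E M r) (X M r) (a M r) (b M r)).
Proof.
  intros. apply localT_ext with (T := fun M r =>
    ⦃ c | exists t, coh_rep (E M r) (X M r) (a M r) (b M r) t /\
       c = ⦃ t' | coh_rep (E M r) (X M r) (a M r) (b M r) t' /\
                  guarded_coh_eq (E M r) (X M r) (a M r) (b M r) t t' ⦄ ⦄).
  - intros M HM r. apply (cls_ext HM). intros c.
    assert (HC : forall t, coh_rep (E M r) (X M r) (a M r) (b M r) t ->
      ⦃ t' | coh_rep (E M r) (X M r) (a M r) (b M r) t' /\
             guarded_coh_eq (E M r) (X M r) (a M r) (b M r) t t' ⦄ =
      ⦃ t' | coh_rep (E M r) (X M r) (a M r) (b M r) t' /\
             coh_eq (E M r) (X M r) t t' ⦄).
    { intros t Ht. apply (cls_ext HM). intros t'. split; intros [Ht' He]; split; auto;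
        apply (guarded_coh_eq_iff HM _ _ (a M r) (b M r)) in He; auto;
        apply (guarded_coh_eq_iff HM _ _ (a M r) (b M r)); auto. }
    split; intros [t [Ht ->]]; exists t; split; auto; rewrite HC; auto.
  - assert (HC : localT (fun M r => ⦃ t' |
      coh_rep (E M (fun n => r (S n))) (X M (fun n => r (S n)))
              (a M (fun n => r (S n))) (b M (fun n => r (S n))) t' /\
      guarded_coh_eq (E M (fun n => r (S n))) (X M (fun n => r (S n)))
              (a M (fun n => r (S n))) (b M (fun n => r (S n))) (r 0) t' ⦄)).
    { apply localT_cls.
      - apply local_and; [loc|apply local_guarded_coh_eq; loc].
      - eapply bd_impl; [apply (bd_coh_rep (fun M r => E M (fun n => r (S n)))
          (fun M r => X M (fun n => r (S n))) (fun M r => a M (fun n => r (S n)))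
          (fun M r => b M (fun n => r (S n)))); loc|tauto]. }
    apply localT_cls.
    + apply local_ex.
      * apply local_and; [loc|]. apply local_eq; [loc|].
        exact (localT_ren _ (fun n => match n with 0 => 0 | S k => S (S k) end) HC).
      * eapply bd_impl; [apply (bd_coh_rep (fun M r => E M (fun n => r (S n)))
          (fun M r => X M (fun n => r (S n))) (fun M r => a M (fun n => r (S n)))
          (fun M r => b M (fun n => r (S n)))); loc|tauto].
    + apply bd_ex with (G := fun M r t => coh_rep (E M r) (X M r) (a M r) (b M r) t).
      * apply bd_coh_rep; auto.
      * eapply bd_eq; [exact HC|]. simpl; tauto.
      * tauto.
Qed.

Lemma local_is_acyclic : local (fun M r => is_acyclic (r 1) (r 0)).
Proof.
  unfold is_acyclic. apply local_and; [loc|].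
  (* The witness [z] is a member of the cohomology set, as [sing z] is that set. *)
  apply (local_ball (fun M r => omega)); [loc| |tauto].
  apply (local_ball (fun M r => omega)); [loc| |tauto].
  do 2 (apply local_imp; [loc|]).
  eapply local_bex; [ | |intros ? ? ? ? ?; component]; [apply localT_cohomology; loc|].
  apply local_eq; [apply localT_cohomology; loc|loc].
Qed.

(** * The formulas *)

(** The matrix of the [Pi 1] definition of a universe: only the closure under
    subsets mentions [z]. *)
Notation universe_at z U :=
  ((forall x, x ∈ U -> forall y, y ∈ x -> y ∈ U) /\
   (forall x, x ∈ U -> (forall v, v ∈ z -> v ∈ x) -> z ∈ U) /\
   (forall x, x ∈ U -> forall a, a ∈ U -> exists y, y ∈ U /\ a ∈ y /\
      (forall v, v ∈ x -> v ∈ y) /\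
      (forall u, u ∈ x -> forall v, v ∈ u -> v ∈ y) /\
      (forall w, w ∈ U -> (forall v, v ∈ w -> v ∈ x) -> w ∈ y)) /\
   (exists x, x ∈ U /\ x = x)).

Notation frame_at z U X E :=
  (universe_at z U /\
   (exists W, W ∈ U /\ forall z', z' ∈ U -> universe_at z' W) /\
   X ∈ U /\ E ∈ U).

Lemma expr_frame_at : expr true (fun M r => frame_at (r 0) (r 1) (r 2) (r 3)).
Proof. express. Qed.

Section Frames.
Context {M : structure} (HM : ZFC M).
Implicit Types z U W X E : M.

Lemma universe_iff U : universe U <-> forall z, universe_at z U.
Proof.
  split.
  - intros HU z. split; [|split; [|split]].
    + intros x Hx y Hy. exact (univ_trans U HU x y Hx Hy).
    + intros x Hx Hz. exact (univ_subset U HU x z Hx Hz).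
    + intros x Hx a Ha. destruct (univ_grow U HU x a Hx Ha) as [y [Hy [Hay H]]].
      exists y. split; [|split; [|split; [|split]]]; auto.
      * intros v Hv. apply H, (in_grow HM); auto.
      * intros u Hu v Hv. apply H, (in_grow HM); eauto.
      * intros w _ Hw. apply H, (in_grow HM); auto.
    + destruct (univ_inhabited U HU) as [x Hx]. eauto.
  - intros H. destruct (H U) as [H1 [_ [H3 [x [Hx _]]]]]. split; eauto.
    + intros y z Hy Hz. destruct (H z) as [_ [H2 _]]. exact (H2 y Hy Hz).
    + intros y a Hy Ha. destruct (H3 y Hy a Ha) as [z [Hz [Haz [h1 [h2 h3]]]]].
      exists z. split; [|split]; auto. intros v Hv.
      apply (in_grow HM) in Hv as [Hv|[[u [Hu Hv]]|Hv]]; eauto.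
      apply h3; auto. destruct (H v) as [_ [H2 _]]. exact (H2 y Hy Hv).
Qed.

(** The subsets of members of [W] are in [U], which bounds the quantifier. *)
Lemma universe_iff_in U W : universe U -> W ∈ U ->
  (universe W <-> forall z, z ∈ U -> universe_at z W).
Proof.
  intros HU HW. rewrite universe_iff. split; [intros H z _; apply H|].
  intros H z. destruct (classic (exists x, x ∈ W /\ subset z x)) as [[x [Hx Hz]]|N].
  - apply H. apply (univ_subset U HU x); auto. apply (univ_trans U HU W); auto.
  - destruct (H W HW) as [H1 [_ [H3 H4]]]. split; [|split; [|split]]; auto.
    intros x Hx Hz. elim N. exists x; auto.
Qed.

Definition frame U X E : Prop :=
  universe U /\ (exists W, W ∈ U /\ universe W) /\ X ∈ U /\ E ∈ U.

Lemma frame_iff U X E : frame U X E <-> forall z, frame_at z U X E.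
Proof.
  split.
  - intros [HU [[W [HW HW']] [HX HE]]] z.
    split; [apply universe_iff; auto|]. split; [|split; eauto].
    exists W. split; auto. apply (universe_iff_in U); auto.
  - intros H. assert (HU : universe U) by (apply universe_iff; intros z; apply H).
    destruct (H U) as [_ [[W [HW HW']] [HX HE]]].
    split; [|split]; auto. exists W. split; auto. apply (universe_iff_in U); auto.
Qed.

Lemma exists_frame X E : exists U, frame U X E.
Proof.
  destruct (exists_universe HM empty) as [W [HW _]].
  destruct (exists_universe HM (upair (upair X E) W)) as [U [HU H]].
  assert (HXE : upair X E ∈ U) by (apply H, (in_upair HM); auto).
  exists U. split; auto. split.
  - exists W. split; auto. apply H, (in_upair HM); auto.
  - split; apply (univ_trans U HU (upair X E)); auto; apply (in_upair HM); auto.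
Qed.

Lemma frame_framed U X E : frame U X E -> exists A, A ∈ U /\ framed A (with_param X E).
Proof.
  intros [HU [[W [HW HW']] [HX HE]]].
  pose proof (universe_upair HM U HU X E HX HE) as HXE.
  destruct (univ_grow U HU (upair X E) W HXE HW) as [A [HA [HWA H]]].
  exists A. split; auto. split; eauto.
  intros [|n]; apply H, (subset_grow HM), (in_upair HM); auto.
Qed.

End Frames.

Theorem theorem9p3 :
  exists phi psi : form,
    Sigma 2 phi /\ Pi 2 psi /\
    forall (M : structure), ZFC M ->
    forall E : M, is_Omega_spectrum E ->
    forall X : M,
      (is_acyclic E X <-> sat (with_param X E) phi) /\
      (is_acyclic E X <-> sat (with_param X E) psi).
Proof.
  destruct expr_frame_at as [f [Hf Hf']], local_is_acyclic as [p Hp].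
  (* Variables 0 and 1 are the set [z] of the matrix and the universe. *)
  pose (q := rel (fun i => S (S i)) 1 p).
  assert (Hq : Delta0 q) by apply Delta0_rel.
  exists (fEx (fAll (fAnd f q))), (fAll (fEx (fImp f q))). split; [|split].
  - exists 0, (fAll (fAnd f q)). split; auto. exists 0, (fAnd f q). split; auto.
    constructor; auto.
  - exists 0, (fEx (fImp f q)). split; auto. exists 0, (fImp f q). split; auto.
    constructor; auto.
  - intros M HM E _ X.
    assert (Hfr : forall U, frame U X E <->
      forall z, sat (scons z (scons U (with_param X E))) f).
    { intros U. rewrite (frame_iff HM). split; intros H z;
        apply (Hf' M (scons z (scons U (with_param X E)))); apply H. }
    assert (Hac : forall U z, frame U X E ->
      (is_acyclic E X <-> sat (scons z (scons U (with_param X E))) q)).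
    { intros U z HU. unfold q. rewrite (sat_rel p _ 1 (with_param X E)) by reflexivity.
      destruct (frame_framed HM U X E HU) as [A [HA HA']].
      apply (Hp M HM U A (with_param X E)); auto. apply HU. }
    simpl. split; split.
    + intros H. destruct (exists_frame HM X E) as [U HU]. exists U. intros z. split.
      * apply Hfr; auto.
      * apply Hac; auto.
    + intros [U H]. apply (Hac U U); [|apply H]. apply Hfr. intros z; apply H.
    + intros H U. destruct (classic (frame U X E)) as [HU|N].
      * exists U. intros _. apply Hac; auto.
      * rewrite Hfr in N. apply not_all_ex_not in N as [z Hz]. exists z. tauto.
    + intros H. destruct (exists_frame HM X E) as [U HU].
      destruct (H U) as [z Hz]. apply (Hac U z HU), Hz, Hfr, HU.
Qed.
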